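(* Assume the setting of the context with $\lambda(x)=|x|^\beta/\beta$, $\beta\in(1,2)$, and the $s_n$-sparse hypothesis space $\Theta$. Assume (C.3), $R_{\lambda\circ l}(\Theta)<\infty$ and $\mathbb{E}H_{Y,X}^\beta<\infty$. Let $\delta\in(0,1/2)$, $\rho,\gamma>0$, $$\alpha=\frac{1}{n^{1/\beta}}\left(\frac{\log(\delta^{-2}/\sqrt{2es_n})+s_n\log[(1+2nr_n)ep/s_n]}{(2^{\beta-1}+1)R_{\lambda\circ l}(\Theta)}\right)^{1/\beta},$$ and let $$\hat\theta_n\in\arg\min_{\theta\in\Theta}\Big\{\frac{1}{n\alpha}\sum_{i=1}^n\psi_\lambda[\alpha l(Y_i,X_i,\theta)]+\rho\|\theta\|_2^2+\gamma\|\theta\|_1\Big\}.$$ Then, with probability at least $1-2\delta$, $$R_l(\hat\theta_n)-\inf_{\theta\in\Theta}R_l(\theta)\le\frac{2\,\mathbb{E}H_{Y,X}}{n}+\frac{C_{\beta,R_{\lambda\circ l}}}{n^{\frac{\beta-1}{\beta}}}\Big(\log\Big(\frac{\delta^{-2}}{\sqrt{2es_n}}\Big)+s_n\log\Big[(1+2nr_n)\frac{ep}{s_n}\Big]\Big)^{\frac{\beta-1}{\beta}}+\|\Theta^*\|_{\rho,\gamma},$$ where $\|\Theta^*\|_{\rho,\gamma}:=\inf_{\theta^*\in\Theta^*}(\rho\|\theta^*\|_2^2+\gamma\|\theta^*\|_1)$ and $$C_{\beta,R_{\lambda\circ l}}:=\frac{2(2^{\beta-1}+1)R_{\lambda\circ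 l}(\Theta)+\frac{2^{\beta-1}}{\beta}\mathbb{E}H_{Y,X}^\beta}{[(2^{\beta-1}+1)R_{\lambda\circ l}(\Theta)]^{\frac{\beta-1}{\beta}}}.$$
   Context: Data and loss: $(X_1,Y_1),\dots,(X_n,Y_n)$ are i.i.d. copies of an $\mathbb{R}^d\times\mathbb{R}$-valued random variable $(X,Y)$. The loss is a (measurable) real function $l(y,x,\theta)$, $\theta\in\Theta\subset\mathbb{R}^p$. Hypothesis space: $\Theta=\{\theta\in\Theta_0:\|\theta\|_0\le s_n\}$, where $\Theta_0\subseteq\mathbb{R}^p$ is convex with $\|\theta\|_2\le r_n$ for all $\theta\in\Theta_0$ for some $r_n\in(0,\infty)$, $\|\theta\|_0$ is the number of nonzero coordinates of $\theta$, and $s_n$ is an integer with $1\le s_n\le p$ ($r_n,s_n$ may depend on $n$; $p$ may exceed $n$). Put $R_l(\theta)=\mathbb{E}[l(Y,X,\theta)]$, $\Theta^*=\arg\min_{\theta\in\Theta}R_l(\theta)$ (the set of all minimizers), and $R_{\lambda\circ l}(\Theta):=\sup_{\theta\in\Theta}\mathbb{E}\{\lambda(l(Y,X,\theta))\}$ (positive, so that $\alpha$ is defined). (C.3) There is $H_{y,x}\ge0$ with $|l(y,x,\theta_2)-l(y,x,\theta_1)|\le H_{y,x}\|\theta_2-\theta_1\|_2$ for all $\theta_1,\theta_2\in\Theta$. Truncation: $\psi_\lambda:\mathbb{R}\to\mathbb{R}$ is a non-decreasing function with $-\log[1-x+\lambda(|x|)]\le\psi_\lambda(x)\le\log[1+x+\lambda(|x|)]$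 for all $x\in\mathbb{R}$. Minimizers $\hat\theta_n$ are assumed to exist (any measurable choice). *)

(* Defs.v *)
From HB Require Import structures.
From mathcomp Require Import all_boot all_order all_algebra.
From mathcomp Require Import all_classical all_reals all_analysis.

Set Implicit Arguments.
Unset Strict Implicit.
Unset Printing Implicit Defensive.

Import Order.TTheory GRing.Theory Num.Theory.
Import numFieldNormedType.Exports.

Local Open Scope classical_set_scope.
Local Open Scope ring_scope.

Section vectors.
Context {R : realType} {p : nat}.
Implicit Types theta : 'rV[R]_p.

(* The library norm `|theta| on 'rV[R]_p is the sup norm. *)
Definition l2norm theta : R := Num.sqrt (\sum_(j < p) theta 0 j ^+ 2).

Definition l1norm theta : R := \sum_(j < p) `|theta 0 j|.

Definition l0norm theta : nat := #|[set j : 'I_p | theta 0 j != 0]%SET|.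

Definition sparse_set (Theta0 : set 'rV[R]_p) (s : nat) : set 'rV[R]_p :=
  [set theta | Theta0 theta /\ (l0norm theta <= s)%N].

Definition penalty (rho gamma : R) theta : R :=
  rho * l2norm theta ^+ 2 + gamma * l1norm theta.

End vectors.

Definition argmin_set {T : Type} {disp : Order.disp_t} {U : porderType disp}
    (A : set T) (f : T -> U) : set T :=
  [set x | A x /\ forall y, A y -> (f x <= f y)%O].

Section truncation.
Context {R : realType}.

Definition pow_lambda (beta x : R) : R := `|x| `^ beta / beta.

Definition truncation (lambda psi : R -> R) : Prop :=
  {homo psi : x y / x <= y} /\
  forall x, - ln (1 - x + lambda `|x|) <= psi x <= ln (1 + x + lambda `|x|).

End truncation.

Section samples.
Context {R : realType} {d d' : measure_display}
  {Omega : measurableType d} {E : measurableType d'} (P : probability Omega R).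

Definition mutually_independent {n : nat} (Z : 'I_n -> {RV P >-> E}) : Prop :=
  forall (J : {set 'I_n}) (B : 'I_n -> set E),
    (forall i, measurable (B i)) ->
    P (\bigcap_(i in [set i | i \in J]) (Z i @^-1` B i)) =
    (\prod_(i in J) P (Z i @^-1` B i))%E.

Definition iid_copies {n : nat} (Zs : 'I_n -> {RV P >-> E})
    (Z : {RV P >-> E}) : Prop :=
  mutually_independent Zs /\
  forall i A, measurable A -> distribution P (Zs i) A = distribution P Z A.

End samples.

Section risk.
Context {R : realType} {d : measure_display} {Omega : measurableType d}
  (P : probability Omega R) {m p : nat}.
(* The observation (X, Y) has X = (Z w).1 in R^m and Y = (Z w).2 in R. *)
Variables (Z : {RV P >-> (m.-tuple R * R)%type})
  (l : R -> m.-tuple R -> 'rV[R]_p -> R).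

Definition risk (theta : 'rV[R]_p) : \bar R :=
  'E_P[fun w => l (Z w).2 (Z w).1 theta]%E.

Definition sup_risk (lambda : R -> R) (Theta : set 'rV[R]_p) : \bar R :=
  ereal_sup [set 'E_P[fun w => lambda (l (Z w).2 (Z w).1 theta)]%E
            | theta in Theta].

(* In \bar R, so that the infimum is +oo when the risk has no minimizer. *)
Definition penalty_of_minimizers (rho gamma : R) (Theta : set 'rV[R]_p) :
    \bar R :=
  ereal_inf [set (penalty rho gamma theta)%:E
            | theta in argmin_set Theta risk].

Definition moment_envelope (H : R -> m.-tuple R -> R) (q : R) : \bar R :=
  'E_P[fun w => (H (Z w).2 (Z w).1 `^ q)%R]%E.

Definition mean_envelope (H : R -> m.-tuple R -> R) : \bar R :=
  'E_P[fun w => H (Z w).2 (Z w).1]%E.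

End risk.

Definition regularized_empirical_risk {R : realType} {n m p : nat}
    (l : R -> m.-tuple R -> 'rV[R]_p -> R) (psi : R -> R)
    (alpha rho gamma : R) (z : 'I_n -> m.-tuple R * R)
    (theta : 'rV[R]_p) : R :=
  (n%:R * alpha)^-1 * (\sum_(i < n) psi (alpha * l (z i).2 (z i).1 theta))
  + penalty rho gamma theta.

Section constants.
Context {R : realType}.

Definition log_complexity (n p s : nat) (r delta : R) : R :=
  ln (delta ^- 2 / Num.sqrt (2 * expR 1 * s%:R))
  + s%:R * ln ((1 + 2 * n%:R * r) * (expR 1 * p%:R / s%:R)).

Definition alpha_tuning (n p s : nat) (r delta beta Rlam : R) : R :=
  (n%:R `^ (1 / beta))^-1
  * (log_complexity n p s r delta / ((2 `^ (beta - 1) + 1) * Rlam))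
    `^ (1 / beta).

Definition C_const (beta Rlam EHbeta : R) : R :=
  (2 * (2 `^ (beta - 1) + 1) * Rlam + 2 `^ (beta - 1) / beta * EHbeta)
  / ((2 `^ (beta - 1) + 1) * Rlam) `^ ((beta - 1) / beta).

End constants.

(* Main.v *)
Require Import Defs.
From HB Require Import structures.
From mathcomp Require Import all_boot all_order all_algebra.
From mathcomp Require Import finmap.
From mathcomp Require Import all_classical all_reals all_analysis.
From mathcomp Require Import measurable_realfun ring lra.

Import Order.TTheory GRing.Theory Num.Theory.
Import numFieldNormedType.Exports.

Local Open Scope classical_set_scope.
Local Open Scope ring_scope.

(* For a single parameter the truncation bounds give
   E exp(psi(W)) <= 1 + E W + E lambda(W) <= exp(E W + E lambda(W)), hence by
   independence a Chernoff bound for the truncated empirical risk in each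
   direction (-psi(-x) is again a truncation).  The upper bound is used at one
   minimizer theta* of the risk; the lower bound is made uniform by a union
   bound over a (1/n)-net of Theta, moving from theta to its net point inside
   the monotone psi at the cost of H/n.  The choice of alpha balances the
   moment terms against the log-cardinality of the net.

   The net of the sparse set has at most 'C(p, s) (1 + 2 n r)^s points, one
   packing bound per support, and s! >= sqrt(2 e s) (s / e)^s turns this into
   the stated complexity.  The infimum over minimizers need not be attained, so
   it is approached by a decreasing sequence of events. *)

(** * Covering numbers of sparse sets *)

Section euclidean_norm.
Context {R : realType} {p : nat}.
Implicit Types x y : 'rV[R]_p.

Lemma l2norm_ge0 x : 0 <= l2norm x.
Proof. exact: sqrtr_ge0. Qed.

Lemma sqr_l2norm x : l2norm x ^+ 2 = \sum_(j < p) x 0 j ^+ 2.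
Proof. by rewrite sqr_sqrtr// sumr_ge0// => j _; exact: sqr_ge0. Qed.

Lemma l2norm_le x c : 0 <= c -> \sum_(j < p) x 0 j ^+ 2 <= c ^+ 2 -> l2norm x <= c.
Proof. by move=> c0; rewrite -sqr_l2norm ler_sqr ?nnegrE ?l2norm_ge0. Qed.

Lemma ler_coord_l2norm x j : `|x 0 j| <= l2norm x.
Proof.
rewrite -ler_sqr ?nnegrE ?l2norm_ge0// sqr_l2norm real_normK ?num_real//.
by rewrite (bigD1 j)//= lerDl sumr_ge0// => i _; exact: sqr_ge0.
Qed.

Lemma l2norm0 : l2norm (0 : 'rV[R]_p) = 0.
Proof. by rewrite /l2norm big1 ?sqrtr0// => j _; rewrite mxE expr0n. Qed.

Lemma l2normN x : l2norm (- x) = l2norm x.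
Proof. by congr Num.sqrt; apply: eq_bigr => j _; rewrite mxE sqrrN. Qed.

Lemma l2normB x y : l2norm (x - y) = l2norm (y - x).
Proof. by rewrite -l2normN opprB. Qed.

Lemma l2normZ c x : 0 <= c -> l2norm (c *: x) = c * l2norm x.
Proof.
move=> c0; rewrite /l2norm.
under eq_bigr do rewrite mxE exprMn.
by rewrite -mulr_sumr sqrtrM ?sqr_ge0// sqrtr_sqr ger0_norm.
Qed.

Lemma dot_le_l2norm x y : \sum_(j < p) x 0 j * y 0 j <= l2norm x * l2norm y.
Proof.
set C := \sum_(j < p) _.
have [x0|x_neq0] := eqVneq (l2norm x) 0.
  rewrite x0 mul0r /C big1// => j _.
  by have := ler_coord_l2norm x j; rewrite x0 normr_le0 => /eqP ->; rewrite mul0r.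
have A0 : 0 < l2norm x by rewrite lt0r x_neq0 l2norm_ge0.
have : 0 <= \sum_(j < p) (l2norm x ^+ 2 * y 0 j - C * x 0 j) ^+ 2.
  by apply: sumr_ge0 => j _; exact: sqr_ge0.
have -> : \sum_(j < p) (l2norm x ^+ 2 * y 0 j - C * x 0 j) ^+ 2 =
    l2norm x ^+ 2 * ((l2norm x * l2norm y) ^+ 2 - C ^+ 2).
  transitivity (\sum_(j < p) ((l2norm x ^+ 2) ^+ 2 * y 0 j ^+ 2
      + - (2 * l2norm x ^+ 2 * C) * (x 0 j * y 0 j) + C ^+ 2 * x 0 j ^+ 2)).
    by apply: eq_bigr => j _; ring.
  rewrite !big_split/= -!mulr_sumr -!sqr_l2norm -/C; ring.
rewrite pmulr_rge0 ?exprn_gt0// subr_ge0 => CAB.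
have AB0 : 0 <= l2norm x * l2norm y by rewrite mulr_ge0// l2norm_ge0.
by rewrite (le_trans (ler_norm _))// -ler_sqr ?nnegrE// real_normK ?num_real.
Qed.

Lemma ler_l2normD x y : l2norm (x + y) <= l2norm x + l2norm y.
Proof.
apply: l2norm_le; first by rewrite addr_ge0 ?l2norm_ge0.
have -> : \sum_(j < p) (x + y) 0 j ^+ 2 =
    l2norm x ^+ 2 + l2norm y ^+ 2 + 2 * \sum_(j < p) x 0 j * y 0 j.
  rewrite !sqr_l2norm mulr_sumr -!big_split/=.
  by apply: eq_bigr => j _; rewrite mxE; ring.
have := dot_le_l2norm x y; nra.
Qed.

Lemma ler_l2normB x y : l2norm (x - y) <= l2norm x + l2norm y.
Proof. by rewrite -(l2normN y) ler_l2normD. Qed.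

Lemma penalty_ge0 (rho gamma : R) x :
  0 <= rho -> 0 <= gamma -> 0 <= penalty rho gamma x.
Proof.
move=> rho0 gamma0; rewrite addr_ge0 ?mulr_ge0 ?exprn_ge0 ?l2norm_ge0//.
by rewrite /l1norm sumr_ge0.
Qed.

End euclidean_norm.

Lemma bounded_powers_le1 (R : realType) (a D : R) :
  0 <= a -> (forall k : nat, a ^+ k <= D) -> a <= 1.
Proof.
move=> a0 aD; rewrite leNgt; apply/negP => a1.
have bern (k : nat) : 1 + k%:R * (a - 1) <= a ^+ k.
  elim: k => [|k IH]; first by rewrite mul0r addr0.
  rewrite exprS -natr1; have k0 : 0 <= k%:R :> R by [].
  have : a * (1 + k%:R * (a - 1)) <= a * a ^+ k by rewrite ler_wpM2l.
  have : 0 <= k%:R * (a - 1) ^+ 2 by rewrite mulr_ge0// sqr_ge0.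
  nra.
have a1' : 0 < a - 1 by rewrite subr_gt0.
have := le_trans (bern (Num.truncn (D / (a - 1))).+1) (aD _).
have D0 : 0 <= D by have := aD 0%N; rewrite expr0; lra.
have /andP[_] := truncn_itv (divr_ge0 D0 (ltW a1')).
rewrite ltr_pdivrMr//; lra.
Qed.

(** * Packing numbers of bounded sets inside a coordinate subspace *)

Section packing.
Context {R : realType} {p N : nat}.
Variables (S : {set 'I_p}) (x : 'I_N -> 'rV[R]_p) (r eps : R).
Hypotheses (r_ge0 : 0 <= r) (eps_gt0 : 0 < eps)
  (x_supp : forall i j, j \notin S -> x i 0 j = 0)
  (x_bounded : forall i, l2norm (x i) <= r)
  (x_sep : forall i j, i != j -> eps < l2norm (x i - x j)).

(** This ratio satisfies [r = eps / 2 * (c - 1)], so a sum of vectors of norms at most [c ^+ j * r]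
    for [j < k] telescopes to the bound [eps / 2 * (c ^+ k - 1)]. *)
Let c : R := 1 + 2 * r / eps.

Let c_ge1 : 1 <= c.
Proof. by rewrite /c lerDl divr_ge0 ?mulr_ge0// ltW. Qed.

(** An expansion in base [c] whose digits are points of the packing. Indexing [w] by [nat] lets
    inductions on [k] keep the same [w]. *)
Let word k (w : nat -> 'I_N) : 'rV[R]_p := \sum_(j < k) c ^+ j *: x (w j).

Let wordS k w : word k.+1 w = word k w + c ^+ k *: x (w k).
Proof. by rewrite /word big_ord_recr. Qed.

Let word_bounded k w : l2norm (word k w) <= eps / 2 * (c ^+ k - 1).
Proof.
elim: k => [|k IH]; first by rewrite /word big_ord0 l2norm0 expr0 subrr mulr0.
rewrite wordS (le_trans (ler_l2normD _ _))// l2normZ; last first.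
  by rewrite exprn_ge0// (le_trans _ c_ge1).
have -> : eps / 2 * (c ^+ k.+1 - 1) = eps / 2 * (c ^+ k - 1) + c ^+ k * r.
  by rewrite exprS /c; field; rewrite gt_eqF.
by rewrite lerD// ler_wpM2l// exprn_ge0// (le_trans _ c_ge1).
Qed.

(** The highest differing digit dominates: it contributes more than [c ^+ k * eps], while the lower
    digits can cancel at most twice [eps / 2 * (c ^+ k - 1)], which leaves more than [eps]. Equal
    top digits cancel and the induction hypothesis applies. *)
Let word_sep k w w' (j : nat) : (j < k)%N -> w j != w' j ->
  eps < l2norm (word k w - word k w').
Proof.
elim: k => // k IH; rewrite ltnS leq_eqVlt => jk wj.
have [wk|wk] := eqVneq (w k) (w' k).
  rewrite !wordS wk opprD addrACA subrr addr0 IH//.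
  by case/orP: jk => // /eqP jk; move: wj; rewrite jk wk eqxx.
have ck0 : 0 < c ^+ k by rewrite exprn_gt0// (lt_le_trans _ c_ge1).
have h1 : c ^+ k * eps < l2norm (c ^+ k *: (x (w k) - x (w' k))).
  by rewrite l2normZ ?ltW// ltr_pM2l// x_sep.
have : l2norm (c ^+ k *: (x (w k) - x (w' k))) <=
    l2norm (word k.+1 w - word k.+1 w') + l2norm (word k w - word k w').
  apply: le_trans (ler_l2normB _ _).
  rewrite !wordS; move: (word k w) (word k w') => u u'.
  rewrite le_eqVlt; apply/orP; left; apply/eqP; congr l2norm.
  by apply/rowP => i; rewrite !mxE; ring.
have := ler_l2normB (word k w) (word k w').
have := word_bounded k w; have := word_bounded k w'; lra.
Qed.

Let word_supp k w j : j \notin S -> word k w 0 j = 0.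
Proof.
by move=> jS; rewrite /word summxE big1// => i _; rewrite mxE x_supp// mulr0.
Qed.

(** Index of a coordinate in a grid of mesh [eps / p.+1]. The shift by [eps / 2 * c ^+ k] makes the
    argument nonnegative on words, so that [Num.truncn] is a true floor there. *)
Let cell k (y : 'rV[R]_p) (j : 'I_p) : nat :=
  Num.truncn ((y 0 j + eps / 2 * c ^+ k) / (eps / p.+1%:R)).

Let cell_num k := (Num.truncn (p.+1%:R * c ^+ k)).+1.

Let h_gt0 : 0 < eps / p.+1%:R.
Proof. by rewrite divr_gt0. Qed.

Let cell_arg_ge0 k w j :
  0 <= (word k w 0 j + eps / 2 * c ^+ k) / (eps / p.+1%:R).
Proof.
apply: divr_ge0; last exact: ltW.
have := word_bounded k w; have := ler_coord_l2norm (word k w) j.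
rewrite ler_norml => /andP[]; have := eps_gt0; move: (c ^+ k) (word k w 0 j) => C v; nra.
Qed.

Let cell_lt k w j : (cell k (word k w) j < cell_num k)%N.
Proof.
rewrite /cell /cell_num ltnS; apply: le_truncn.
rewrite ler_pdivrMr//.
have -> : p.+1%:R * c ^+ k * (eps / p.+1%:R) = eps * c ^+ k.
  by field; rewrite addrC natr1 pnatr_eq0.
have := word_bounded k w; have := ler_coord_l2norm (word k w) j.
rewrite ler_norml => /andP[]; have := eps_gt0; move: (c ^+ k) (word k w 0 j) => C v; nra.
Qed.

(** Coordinates in a common cell differ by at most the mesh, and those outside [S] vanish; the
    squared distance is thus at most [p * (eps / p.+1) ^+ 2], which is below [eps ^+ 2]. *)
Let cell_sep k w w' :
  (forall j, j \in S -> cell k (word k w) j = cell k (word k w') j) ->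
  l2norm (word k w - word k w') <= eps.
Proof.
move=> ww'; apply: l2norm_le; first exact: ltW.
apply: (@le_trans _ _ (\sum_(j < p) (eps / p.+1%:R) ^+ 2)); last first.
  rewrite sumr_const card_ord -[leLHS]mulr_natl expr_div_n mulrCA ler_piMr ?sqr_ge0//.
  rewrite ler_pdivrMr ?exprn_gt0// mul1r expr2 -natrM ler_nat.
  by rewrite (leq_trans (leqnSn _))// leq_pmulr.
apply: ler_sum => j _; have [jS|jS] := boolP (j \in S); last first.
  by rewrite !mxE !word_supp// subrr expr0n sqr_ge0.
rewrite -[leLHS]real_normK ?num_real// ler_sqr ?nnegrE ?(ltW h_gt0)//.
have := ww' j jS; rewrite /cell.
have /andP[] := truncn_itv (cell_arg_ge0 k w j).
have /andP[] := truncn_itv (cell_arg_ge0 k w' j).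
move=> a b a' b' E; move: a b a' b'; rewrite E.
move: (eps / p.+1%:R) h_gt0 => h h0; set t := Num.truncn _.
rewrite !ler_pdivlMr// !ltr_pdivrMr// -(natr1 t) mulrDl mul1r !mxE => *.
rewrite ler_norml; apply/andP; split; lra.
Qed.

(** Pigeonhole: words with the same cells on [S] are within [eps] of each other by [cell_sep], which
    [word_sep] forbids for distinct words. *)
Let words_le k : (N ^ k <= cell_num k ^ #|S|)%N.
Proof.
case: (posnP N) => [N0|N0].
  case: k => [|k]; last by rewrite N0 exp0n.
  by rewrite expn0 expn_gt0.
(* The letter [Ordinal N0] only fills positions from [k] on, which [word k] never reads. In [code],
   the value [ord0] off [S] makes codes functions supported in [S], whence the exponent [#|S|]. *)
pose ext (w : {ffun 'I_k -> 'I_N}) (j : nat) : 'I_N :=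
  if insub j is Some i then w i else Ordinal N0.
pose code (w : {ffun 'I_k -> 'I_N}) : {ffun 'I_p -> 'I_(cell_num k)} :=
  [ffun j => if j \in S then inord (cell k (word k (ext w)) j) else ord0].
have code_inj : injective code.
  move=> w w' ww'; apply/ffunP => i; apply/eqP/negP => /negP wi.
  have : l2norm (word k (ext w) - word k (ext w')) <= eps.
    apply: cell_sep => j jS.
    move/ffunP/(_ j)/(congr1 val) : ww'.
    by rewrite !ffunE jS/= !inordK ?cell_lt.
  rewrite leNgt (@word_sep _ _ _ i)// /ext.
  by case: insubP => [i' _ /val_inj ->|]//; rewrite ltn_ord.
have : (#|codom code| <= #|pffun_on (ord0 : 'I_(cell_num k)) (mem S) predT|)%N.
  apply: subset_leq_card; apply/fintype.subsetP => _ /codomP[w ->].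
  apply/pffun_onP; split=> //; apply/fintype.subsetP => j.
  by rewrite inE ffunE; case: ifP => //; rewrite eqxx.
by rewrite card_codom// card_ffun card_pffun_on !card_ord.
Qed.

(* The [N ^ k] points [\sum_(j < k) c ^+ j *: x (w j)] are still eps-separated
   and lie in a ball of radius [eps / 2 * c ^+ k]: a crude grid count of such a
   set, correct up to a factor that does not depend on [k], gives the sharp
   constant as [k] tends to infinity. *)
Lemma packing_bound : N%:R <= c ^+ #|S|.
Proof.
have c0 : 0 < c by rewrite (lt_le_trans _ c_ge1).
rewrite -[leRHS]mul1r -ler_pdivrMr ?exprn_gt0//.
(* The factor [p.+2] arises from [cell_num k <= p.+1 * c ^+ k + 1 <= p.+2 * c ^+ k], as
   [c ^+ k >= 1]. *)
apply: (@bounded_powers_le1 _ _ (p.+2%:R ^+ #|S|)).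
  by rewrite divr_ge0// exprn_ge0// ltW.
move=> k; rewrite expr_div_n ler_pdivrMr ?exprn_gt0//.
rewrite -exprM mulnC exprM -exprMn.
have := words_le k; rewrite -(ler_nat R) !natrX => /le_trans -> //.
have ck0 : 0 <= c ^+ k by rewrite exprn_ge0// ltW.
rewrite lerXn2r ?nnegrE ?mulr_ge0//.
have ck1 : 1 <= c ^+ k by rewrite exprn_ege1.
have : (Num.truncn (p.+1%:R * c ^+ k))%:R <= p.+1%:R * c ^+ k.
  by rewrite truncn_le// mulr_ge0.
rewrite /cell_num; set t := Num.truncn _; rewrite -(natr1 t) -(natr1 p.+1).
move: (p.+1%:R) (t%:R) => q u; nra.
Qed.

End packing.

(** * A Stirling-type lower bound for the factorial *)

(** The right-hand side is the Padé approximant of type (2, 1) at [0]. Its difference with the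
    logarithm vanishes at [0] and has a nonnegative derivative, so the mean value theorem
    applies. *)
Lemma ln1D_le_pade (R : realType) (x : R) :
  0 <= x -> ln (1 + x) <= x * (6 + x) / (6 + 4 * x).
Proof.
move=> x0.
(* Partial fractions of the approximant in [y = 1 + x], minus [ln y]; the additive constant is
   recovered by subtracting [g 1]. *)
pose g (y : R) := 4^-1 * y - (27 / 4) * (4 * y + 2)^-1 - ln y.
pose dg (y : R) := 1 / 4 + 27 * (4 * y + 2) ^- 2 - y^-1.
have dgP (y : R) : 0 < y -> is_derive y 1 g (dg y).
  move=> y0; have ? := is_derive1_ln y0.
  have y42 : 4 * y + 2 != 0 by rewrite gt_eqF// addr_gt0// mulr_gt0.
  have ? : is_derive y 1 (fun y : R => (4 * y + 2)^-1) (- (4 * y + 2) ^- 2 *: 4).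
    apply: is_derive_eq.
    by rewrite addr0 /GRing.scale/= mulr1.
  rewrite /g; apply: is_derive_eq.
  rewrite /dg /GRing.scale/=; field.
  by rewrite y42 gt_eqF.
have [|||c /[!in_itv]/= /andP[c1 _] E] := @MVT_segment R g dg 1 (1 + x).
- by rewrite lerDl.
- by move=> y; rewrite in_itv/= => /andP[y1 _]; apply: dgP; lra.
- apply: derivable_within_continuous => y; rewrite in_itv/= => /andP[y1 _].
  have y0 : 0 < y by lra.
  by case: (dgP y y0).
have c0 : 0 < c by lra.
have : 0 <= g (1 + x) - g 1.
  rewrite E addrAC subrr add0r mulr_ge0//.
  have -> : dg c = (c - 1) ^+ 3 / (c * (2 * c + 1) ^+ 2).
    by rewrite /dg; field; rewrite !gt_eqF; lra.
  by rewrite divr_ge0 ?exprn_ge0 ?mulr_ge0 ?sqr_ge0//; lra.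
rewrite /g ln1 subr0 -subr_ge0.
have -> : x * (6 + x) / (6 + 4 * x) =
    (1 + x) / 4 - 27 / 4 / (4 * (1 + x) + 2) - (1 / 4 - 27 / 4 / (4 * 1 + 2)).
  by field; rewrite !gt_eqF; lra.
by rewrite subr_ge0; lra.
Qed.

(** Since [expR (3 / 4)] is the eighth power of [expR (3 / 32)], it is at least [(1 + 3 / 32) ^+ 8],
    which exceeds [2]. *)
Lemma ln2_le (R : realType) : ln (2 : R) <= 3 / 4.
Proof.
rewrite -[leRHS]expRK ler_ln ?posrE ?expR_gt0//.
have -> : 3 / 4 = 8%:R * (3 / 32) :> R by field.
rewrite expRM_natl; have := expR_ge1Dx (3 / 32 : R).
move: (expR _) => e e1; apply: (@le_trans _ _ ((1 + 3 / 32) ^+ 8)); first by lra.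
by rewrite lerXn2r ?nnegrE//; lra.
Qed.

(** Induction on [s], with equality at [s = 1]. The correction [(8 * s)^-1] telescopes and absorbs
    the error of the approximant of [ln (1 + t^-1)] at each step. *)
Lemma ln_fact_ge (R : realType) (s : nat) : (0 < s)%N ->
  (s%:R + 1 / 2) * ln s%:R - s%:R + 7 / 8 + (8 * s%:R)^-1 <= ln (s`!%:R : R).
Proof.
case: s => // s _; elim: s => [|s IH].
  by rewrite (_ : 1`!%:R = 1 :> R)// ln1; lra.
rewrite factS natrM lnM ?posrE ?ltr0n ?fact_gt0//.
pose t : R := s.+1%:R; have t0 : 0 < t by rewrite ltr0n.
have -> : s.+2%:R = t + 1 :> R by rewrite natr1.
move: IH; rewrite -/t => IH.
have step : (t + 1 / 2) * (ln (t + 1) - ln t) <=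
    1 + (8 * t)^-1 - (8 * (t + 1))^-1.
  have -> : ln (t + 1) - ln t = ln (1 + t^-1).
    by rewrite -ln_div ?posrE//; [congr ln; field; rewrite gt_eqF|lra].
  have /ln1D_le_pade h : 0 <= t^-1 by rewrite invr_ge0 ltW.
  apply: le_trans (ler_wpM2l _ h) _; first lra.
  rewrite -subr_ge0.
  have -> : 1 + (8 * t)^-1 - (8 * (t + 1))^-1 -
      (t + 1 / 2) * (t^-1 * (6 + t^-1) / (6 + 4 * t^-1)) =
      t / (8 * t * (t + 1) * (3 * t + 2)).
    by field; rewrite !gt_eqF; lra.
  by rewrite !(mulr_ge0, divr_ge0, invr_ge0)//; lra.
move: IH step; move: (8 * t)^-1 (8 * (t + 1))^-1 => u v.
move: (ln t) (ln (t + 1)) (ln (s.+1)`!%:R) => a b f.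
lra.
Qed.

(** After taking logarithms, the constant on the left is [1 / 2 + ln 2 / 2], which is at most the
    [7 / 8] of [ln_fact_ge] exactly when [ln 2 <= 3 / 4]. *)
Lemma fact_ge (R : realType) (s : nat) : (0 < s)%N ->
  Num.sqrt (2 * expR 1 * s%:R) * (s%:R / expR 1) ^+ s <= s`!%:R :> R.
Proof.
move=> s0; have t0 : 0 < s%:R :> R by rewrite ltr0n.
have e0 : 0 < expR 1 :> R by exact: expR_gt0.
have q0 : 0 < 2 * expR 1 * s%:R :> R by rewrite !mulr_gt0.
rewrite -ler_ln ?posrE ?ltr0n ?fact_gt0//; last first.
  by rewrite mulr_gt0 ?sqrtr_gt0// exprn_gt0// divr_gt0.
rewrite lnM ?posrE ?sqrtr_gt0// ?exprn_gt0 ?divr_gt0//.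
rewrite lnXn ?divr_gt0// ln_div// expRK.
rewrite -powR12_sqrt ?ltW// ln_powR !lnM ?posrE ?mulr_gt0// expRK.
have := ln_fact_ge R s s0; have := ln2_le R.
have : 0 < (8 * s%:R)^-1 :> R by rewrite invr_gt0 mulr_gt0.
rewrite -(mulr_natl (ln s%:R - 1) s).
move: (ln 2) (ln s%:R) (ln s`!%:R) ((8 * s%:R)^-1) => a b f u.
lra.
Qed.

(** * Finite nets of sparse sets *)

(** The net points are taken in [A] itself because the loss is only controlled on the parameter
    set. *)
Definition eps_net {R : realType} {p : nat} (A : set 'rV[R]_p) (eps : R)
    (t : seq 'rV[R]_p) : Prop :=
  (forall x, x \in t -> A x) /\
  forall y, A y -> exists2 x, x \in t & l2norm (y - x) <= eps.

Section nets.
Context {R : realType} {p : nat}.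
Implicit Types (A : set 'rV[R]_p) (S : {set 'I_p}).

(** A packing of maximal cardinality is a net: a point farther than [eps] from all its points could
    be added to it. A maximum exists because [packing_bound] bounds the cardinalities. *)
Lemma exists_net A S (r eps : R) : 0 <= r -> 0 < eps ->
  (forall x j, A x -> j \notin S -> x 0 j = 0) ->
  (forall x, A x -> l2norm x <= r) ->
  exists2 t, eps_net A eps t & (size t)%:R <= (1 + 2 * r / eps) ^+ #|S|.
Proof.
move=> r0 eps0 AS Ar.
pose packing (N : nat) := exists2 x : 'I_N -> 'rV[R]_p, (forall i, A (x i)) &
  forall i j, i != j -> eps < l2norm (x i - x j).
have pack_le N : packing N -> N%:R <= (1 + 2 * r / eps) ^+ #|S|.
  case=> x xA xsep; apply: (packing_bound S x) => //.
    by move=> i j; exact: AS.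
  by move=> i; exact: Ar.
have packing0 : exists N, `[< packing N >].
  by exists 0%N; apply/asboolP; exists (fun=> 0) => -[].
have pack_ub N : `[< packing N >] ->
    (N <= Num.truncn ((1 + 2 * r / eps) ^+ #|S|))%N.
  move=> /asboolP/pack_le N_le; rewrite truncn_ge_nat//.
  exact: le_trans N_le.
case: (ex_maxnP packing0 pack_ub) => N /asboolP[x xA xsep] Nmax.
exists (codom x); last by rewrite size_codom card_ord; apply: pack_le; exists x.
split=> [_ /codomP[i ->]//|y Ay].
have [[i yi]|far] := pselect (exists i, l2norm (y - x i) <= eps).
  by exists (x i) => //; exact: codom_f.
suff /asboolP/Nmax : packing N.+1 by rewrite ltnn.
(* The far point [y] is appended at the last index; all other indices are read in [x]. *)
exists (fun i => oapp x y (unlift ord_max i)).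
  by move=> i; case: unlift => [j|] /=; [exact: xA|exact: Ay].
have sep_y i : eps < l2norm (y - x i).
  by rewrite ltNge; apply/negP => yi; apply: far; exists i.
move=> i j; case: unliftP => [i'|] ->; case: unliftP => [j'|] -> //=.
- by rewrite (inj_eq lift_inj); exact: xsep.
- by rewrite l2normB.
- by rewrite eqxx.
Qed.

(** As [s <= p], a smaller support can be padded to exactly [s] coordinates, so only ['C(p, s)]
    supports have to be counted. *)
Lemma sparse_setE (Theta0 : set 'rV[R]_p) (s : nat) : (s <= p)%N ->
  sparse_set Theta0 s = \bigcup_(S in [set S : {set 'I_p} | #|S| = s])
    [set x | Theta0 x /\ forall j, j \notin S -> x 0 j = 0].
Proof.
move=> sp; apply/seteqP; split => [x [x0 xs]|x [S /= Ss [x0 xS]]]; last first.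
  split=> //; rewrite /l0norm -Ss; apply/subset_leq_card/fintype.subsetP => j.
  by rewrite inE; apply: contraNT => /xS ->.
have [S Ss xS] : exists2 S : {set 'I_p}, #|S| = s &
    [set j : 'I_p | x 0 j != 0]%SET \subset S.
  move: xs; rewrite /l0norm; set B := [set j | _]%SET => xs.
  have [S' S'B S's] : exists2 S' : {set 'I_p}, S' \subset ~: B & #|S'| = (s - #|B|)%N.
    have : (s - #|B| <= #|~: B|)%N by rewrite [#|~: B|]cardsCs finset.setCK card_ord leq_sub2r.
    by move=> /card_geqP[t [ut ts tB]]; exists [set j in t]%SET;
       [apply/fintype.subsetP => j; rewrite inE; exact: tB|rewrite cardsE (card_uniqP ut)].
  exists (B :|: S')%SET; last exact: finset.subsetUl.
  rewrite cardsU (_ : B :&: S' = finset.set0)%SET ?cards0 ?subn0 ?S's ?subnKC//.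
  by apply/eqP; rewrite finset.setI_eq0 disjoint_sym finset.disjoints_subset.
exists S => //; split=> // j; apply: contraNeq => xj.
by apply: (fintype.subsetP xS); rewrite inE.
Qed.

Lemma exists_sparse_net (Theta0 : set 'rV[R]_p) (r eps : R) (s : nat) :
  0 <= r -> 0 < eps -> (forall x, Theta0 x -> l2norm x <= r) -> (s <= p)%N ->
  exists2 t, eps_net (sparse_set Theta0 s) eps t &
    (size t)%:R <= 'C(p, s)%:R * (1 + 2 * r / eps) ^+ s.
Proof.
move=> r0 eps0 Theta0r sp; rewrite sparse_setE//.
pose A S := [set x : 'rV[R]_p | Theta0 x /\ forall j, j \notin S -> x 0 j = 0].
have /choice[net netP] (S : {set 'I_p}) : exists t : seq 'rV[R]_p,
    eps_net (A S) eps t /\ (size t)%:R <= (1 + 2 * r / eps) ^+ #|S|.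
  have AS x j : A S x -> j \notin S -> x 0 j = 0 by case=> _; exact.
  have Ar x : A S x -> l2norm x <= r by case=> + _; exact: Theta0r.
  by have [t] := exists_net (A S) S r eps r0 eps0 AS Ar; exists t.
pose Ss := enum [set S : {set 'I_p} | #|S| == s]%SET.
have SsP S : (S \in Ss) = (#|S| == s) by rewrite mem_enum inE.
exists (flatten [seq net U | U <- Ss]).
  split=> [x /flatten_mapP[S]|y [S /= Sc Ay]].
    by rewrite SsP => /eqP Sc xS; exists S => //; exact: (netP S).1.1.
  have [x xS yx] := (netP S).1.2 y Ay; exists x => //.
  by apply/flatten_mapP; exists S => //; rewrite SsP Sc.
rewrite size_flatten /shape -map_comp sumnE big_map natr_sum.
apply: (@le_trans _ _ (\sum_(S <- Ss) (1 + 2 * r / eps) ^+ s)).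
  rewrite big_seq [leRHS]big_seq; apply: ler_sum => S.
  by rewrite SsP => /eqP <-; exact: (netP S).2.
rewrite big_const_seq count_predT iter_addr_0 -cardE card_draws card_ord.
by rewrite -[leLHS]mulr_natl.
Qed.

(** Multiply both sides by [(s / e) ^+ s]: by [fact_ge] the left is then controlled by
    ['C(p, s) * s! = p ^_ s], which is at most [p ^+ s]. *)
Lemma sparse_covering_bound (n s : nat) (r : R) : 0 <= r -> (0 < s)%N ->
  Num.sqrt (2 * expR 1 * s%:R) * ('C(p, s)%:R * (1 + 2 * n%:R * r) ^+ s) <=
  ((1 + 2 * n%:R * r) * (expR 1 * p%:R / s%:R)) ^+ s.
Proof.
move=> r0 s0; have t0 : 0 < s%:R :> R by rewrite ltr0n.
have e0 : 0 < expR 1 :> R by exact: expR_gt0.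
rewrite [leRHS]exprMn mulrA [leLHS]mulrC; apply: ler_wpM2l.
  by rewrite exprn_ge0// addr_ge0 ?mulr_ge0.
have w0 : 0 < (s%:R / expR 1) ^+ s :> R by rewrite exprn_gt0 ?divr_gt0.
rewrite -(ler_pM2r w0) -[leRHS]exprMn.
have -> : expR 1 * p%:R / s%:R * (s%:R / expR 1) = p%:R :> R.
  by field; rewrite !gt_eqF.
have := ler_wpM2l (ler0n R 'C(p, s)) (@fact_ge R s s0).
rewrite -natrM bin_ffact => h.
have fp : (p ^_ s)%:R <= p%:R ^+ s :> R.
  rewrite -natrX ler_nat; elim: (s) => // k IH.
  by rewrite ffactnSr expnSr leq_mul ?leq_subr.
by apply: (le_trans _ fp); apply: (le_trans _ h); rewrite mulrAC [leLHS]mulrC.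
Qed.

End nets.

(** * Deviations of truncated sums *)

Section independence.
Context {R : realType} {d d' : measure_display}
  {Omega : measurableType d} {E : measurableType d'} (P : probability Omega R).
Context {n : nat} (Zs : 'I_n -> {RV P >-> E}).
Hypothesis Zs_indep : mutually_independent Zs.

Import HBNNSimple.

(** Write [g] as a combination of indicators of its level sets and expand the product over all
    assignments [phi] of a level set to each index. Independence factors the probability of each
    intersection, and the sum is folded back by distributivity. *)
Lemma integral_prod_nnsfun (g : {nnsfun E >-> R}) :
  (\int[P]_w (\prod_(i < n) g (Zs i w))%:E =
   \prod_(i < n) \int[P]_w (g (Zs i w))%:E)%E.
Proof.
pose s := fset_set (range g); pose m := #|` s|.
pose a (k : 'I_m) : R := s`_k; pose A (k : 'I_m) := g @^-1` [set a k].
have mA k : measurable (A k) by exact: measurable_funPTI.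
have a0 k : 0 <= a k.
  have : a k \in s by exact: mem_nth.
  by rewrite in_fset_set// inE => -[x _ <-].
have gE x : g x = \sum_(k < m) a k * \1_(A k) x by exact: fimfunEord.
have mZ i k : measurable (Zs i @^-1` A k) by exact: measurable_funPTI.
pose q i k : R := fine (P (Zs i @^-1` A k)).
have qE i k : P (Zs i @^-1` A k) = (q i k)%:E.
  by rewrite /q fineK// fin_num_measure.
have int1 i : (\int[P]_w (g (Zs i w))%:E = (\sum_(k < m) a k * q i k)%:E)%E.
  under eq_integral do rewrite gE -sumEFin.
  rewrite ge0_integral_sum//; last 2 first.
  - move=> k; apply/measurable_EFinP/measurable_funM => //.
    by apply: (measurableT_comp (f := \1_(A k) : E -> R) (g := Zs i)) => //; exact: measurable_indic.
  - by move=> k w _; rewrite lee_fin mulr_ge0.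
  rewrite -sumEFin; apply: eq_bigr => k _.
  under eq_integral do rewrite EFinM.
  rewrite ge0_integralZl_EFin//.
    rewrite EFinM -qE -[in RHS](setIT (_ @^-1` _)) -integral_indic//.
  by apply/measurable_EFinP; apply: (measurableT_comp (f := \1_(A k) : E -> R) (g := Zs i)) => //; exact: measurable_indic.
under [RHS]eq_bigr do rewrite int1.
rewrite prodEFin bigA_distr_bigA/= -sumEFin.
pose B (phi : {ffun 'I_n -> 'I_m}) :=
  \bigcap_(i in [set i | i \in [set: 'I_n]%SET]) (Zs i @^-1` A (phi i)).
have mB phi : measurable (B phi) by apply: fin_bigcap_measurable.
have prodE w : \prod_(i < n) g (Zs i w) =
    \sum_(phi : {ffun 'I_n -> 'I_m}) (\prod_(i < n) a (phi i)) * \1_(B phi) w.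
  under eq_bigr do rewrite gE.
  rewrite bigA_distr_bigA/=; apply: eq_bigr => phi _.
  rewrite big_split/=; congr (_ * _); rewrite indicE.
  have [wB|wB] := boolP (w \in B phi).
    rewrite big1// => i _; rewrite indicE mem_set//.
    by move: wB; rewrite inE => /(_ i); apply => /=; rewrite inE.
  apply/eqP/prodf_eq0; move: wB; rewrite notin_setE => wB.
  apply: contrapT => noi; apply: wB => i _ /=.
  apply: contrapT => wi; apply: noi; exists i => //.
  by rewrite indicE memNset.
under eq_integral do rewrite prodE -sumEFin.
rewrite ge0_integral_sum//; last 2 first.
- by move=> phi; apply/measurable_EFinP/measurable_funM => //; exact: measurable_indic.
- by move=> phi w _; rewrite lee_fin mulr_ge0// prodr_ge0.
apply: eq_bigr => phi _.
under eq_integral do rewrite EFinM.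
rewrite ge0_integralZl_EFin//; [|exact/measurable_EFinP/measurable_indic|exact: prodr_ge0].
rewrite integral_indic// setIT big_split/= EFinM; congr (_ * _)%E.
rewrite (Zs_indep [set: 'I_n]%SET (fun i => A (phi i)))// -prodEFin.
by apply: eq_big => [i|i _]; rewrite ?inE.
Qed.

(** Monotone convergence along simple functions increasing to [f], whose individual integrals stay
    below [M]. An upper bound suffices for the Chernoff argument. *)
Lemma integral_prod_le (f : E -> R) (M : R) :
  measurable_fun [set: E] f -> (forall x, 0 <= f x) ->
  (forall i, \int[P]_w (f (Zs i w))%:E <= M%:E)%E ->
  (\int[P]_w (\prod_(i < n) f (Zs i w))%:E <= (M ^+ n)%:E)%E.
Proof.
move=> mf f0 fM.
have mEf : measurable_fun [set: E] (EFin \o f) by exact/measurable_EFinP.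
pose g := nnsfun_approx measurableT mEf.
pose G k w := (\prod_(i < n) g k (Zs i w))%:E.
have mgZ k i : measurable_fun setT (fun w => g k (Zs i w)).
  by apply: measurableT_comp.
have g_cvg x : g ^~ x @ \oo --> f x.
  have /fine_cvgP[_] := @cvg_nnsfun_approx _ _ _ _ measurableT _ mEf
    (fun x _ => f0 x : (0 <= (EFin \o f) x)%E) x Logic.I.
  by apply: cvg_trans; apply: near_eq_cvg; exact: nearW.
have ndg i j x : (i <= j)%N -> g i x <= g j x.
  by move=> ij; have /lefP := nd_nnsfun_approx measurableT mEf ij; exact.
have g_le k x : g k x <= f x.
  have nd : nondecreasing_seq (g ^~ x).
    by move=> i j; exact: ndg.
  have := nondecreasing_cvgn_le nd (cvgP _ (g_cvg x)) k.
  by rewrite (cvg_lim _ (g_cvg x)).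
have limG w : limn (G ^~ w) = (\prod_(i < n) f (Zs i w))%:E.
  apply: cvg_lim => //; apply: cvg_EFin; first exact: nearW.
  apply: cvg_big => [|i _]; first exact: mul_continuous.
  exact: g_cvg.
have mG k : measurable_fun setT (G k).
  by apply/measurable_EFinP; apply: measurable_prod => i _.
have G0 k w : [set: Omega] w -> (0 <= G k w)%E.
  by move=> _; rewrite lee_fin prodr_ge0.
have ndG w : [set: Omega] w -> {homo G ^~ w : i j / (i <= j)%N >-> (i <= j)%E}.
  move=> _ i j ij; rewrite lee_fin; apply: ler_prod => k _; rewrite fun_ge0/=.
  exact: ndg.
have := @cvg_monotone_convergence _ _ _ P _ measurableT G mG G0 ndG.
under eq_integral do rewrite limG.
move=> cvgG; rewrite -(cvg_lim _ cvgG)//.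
apply: lime_le; first exact: cvgP cvgG.
apply: nearW => k; rewrite integral_prod_nnsfun.
have -> : (M ^+ n)%:E = (\prod_(i < n) M%:E)%E.
  by rewrite prodEFin prodr_const card_ord.
have lei i : (0 <= \int[P]_w (g k (Zs i w))%:E <= M%:E)%E.
  rewrite integral_ge0/=; last by move=> w _; rewrite lee_fin.
  apply: le_trans (fM i); apply: ge0_le_integral => //.
  - by move=> w _; rewrite lee_fin.
  - exact/measurable_EFinP.
  - by apply/measurable_EFinP/measurableT_comp.
  - by move=> w _; rewrite lee_fin.
(* Finiteness of the factors lets the products be compared in [R] instead of the extended reals. *)
have lei_fin i : (\int[P]_w (g k (Zs i w))%:E = (fine (\int[P]_w (g k (Zs i w))%:E))%:E)%E.
  by case/andP: (lei i) => le0 leM; rewrite fineK// ge0_fin_numE// (le_lt_trans leM)// ltry.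
under eq_bigr do rewrite lei_fin.
rewrite !prodEFin lee_fin; apply: ler_prod => i _.
by rewrite -!lee_fin -lei_fin.
Qed.

End independence.

(** * Truncation functions and their exponential moments *)

Section truncation_theory.
Context {R : realType}.
Variables (beta : R) (psi : R -> R).
Hypothesis beta_gt1 : 1 < beta.
Implicit Types x : R.

Let beta_gt0 : 0 < beta.
Proof. exact: lt_trans beta_gt1. Qed.

Lemma pow_lambda_ge0 x : 0 <= pow_lambda beta x.
Proof. by rewrite /pow_lambda divr_ge0 ?powR_ge0// ltW. Qed.

Lemma pow_lambda_norm x : pow_lambda beta `|x| = pow_lambda beta x.
Proof. by rewrite /pow_lambda normr_id. Qed.

Lemma pow_lambdaM a x : 0 <= a -> pow_lambda beta (a * x) = a `^ beta * pow_lambda beta x.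
Proof. by move=> a0; rewrite /pow_lambda normrM ger0_norm// powRM// mulrA. Qed.

Lemma pow_lambdaN x : pow_lambda beta (- x) = pow_lambda beta x.
Proof. by rewrite /pow_lambda normrN. Qed.

(** Young's inequality for the product of [|x|] and [1] with conjugate exponents [beta] and
    [beta / (beta - 1)]. *)
Lemma norm_le_pow_lambda x : `|x| + beta^-1 <= pow_lambda beta x + 1.
Proof.
have q0 : 0 < beta / (beta - 1) by rewrite divr_gt0// subr_gt0.
have := @conjugate_powR _ `|x| 1 beta _ (normr_ge0 x) ler01 beta_gt0 q0.
rewrite powR1 !mulr1 mul1r invf_div => young.
have -> : pow_lambda beta x + 1 = `|x| `^ beta / beta + (beta - 1) / beta + beta^-1.
  by rewrite /pow_lambda; field; rewrite gt_eqF.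
rewrite lerD2r; apply: young.
by field; rewrite gt_eqF.
Qed.

(** Convexity of the power [beta] at the midpoint of [|x|] and [|y|]; this is where the factor
    [2 ^ (beta - 1)] of the final constants originates. *)
Lemma pow_lambdaD x y : pow_lambda beta (x + y) <=
  2 `^ (beta - 1) * (pow_lambda beta x + pow_lambda beta y).
Proof.
have h0 : 0 <= 2^-1 :> R by [].
have h1 : 2^-1 <= 1 :> R by lra.
have nn (z : R) : `|z| \in (`[0, +oo[%classic : set R).
  by rewrite inE/= in_itv/= normr_ge0.
have cvx : (2^-1 * (`|x| + `|y|)) `^ beta <=
    2^-1 * (`|x| `^ beta + `|y| `^ beta).
  rewrite !mulrDr {2 4}(_ : 2^-1 = 1 - 2^-1); last by field.
  exact: (convex_powR (ltW beta_gt1) (Itv01 h0 h1) (nn x) (nn y)).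
rewrite powRM ?addr_ge0// in cvx.
have p2 : 2 `^ (beta - 1) = 2^-1 * 2 `^ beta :> R.
  by rewrite powRD ?powR_inv1 1?mulrC// ?pnatr_eq0 ?implybT.
have : (`|x| + `|y|) `^ beta <= 2 `^ (beta - 1) * (`|x| `^ beta + `|y| `^ beta).
  have c2 : (2^-1) `^ beta * 2 `^ beta = 1 :> R.
    by rewrite -powRM// mulVf ?powR1.
  have e2 : 0 < 2 `^ beta :> R by rewrite powR_gt0.
  have := ler_wpM2l (ltW e2) cvx; rewrite mulrA [_ * 2^-1 `^ _]mulrC c2 mul1r.
  by rewrite p2 mulrA [2^-1 * _]mulrC.
move=> h; rewrite /pow_lambda -mulrDl mulrA ler_wpM2r ?invr_ge0 ?(ltW beta_gt0)//.
apply: le_trans h; apply: ge0_ler_powR; rewrite ?nnegrE ?addr_ge0 ?(ltW beta_gt0)//.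
exact: ler_normD.
Qed.

(** Cancelling [expR] against [ln] needs a positive argument; [norm_le_pow_lambda] bounds it below
    by [beta^-1]. *)
Lemma expR_truncation_le x : truncation (pow_lambda beta) psi ->
  expR (psi x) <= 1 + x + pow_lambda beta x.
Proof.
move=> [_ /(_ x)/andP[_]]; rewrite pow_lambda_norm => psi_le.
rewrite -[leRHS]lnK ?ler_expR// posrE.
have := norm_le_pow_lambda x; have : 0 < beta^-1 by rewrite invr_gt0.
have := ler_norm (- x); rewrite normrN; lra.
Qed.

Lemma truncationN : truncation (pow_lambda beta) psi ->
  truncation (pow_lambda beta) (fun x => - psi (- x)).
Proof.
move=> [psi_nd psi_bnd]; split=> [x y xy|x]; first by rewrite lerN2 psi_nd// lerN2.
have /andP[] := psi_bnd (- x); rewrite opprK normrN => h1 h2.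
by apply/andP; split; [rewrite lerN2|rewrite lerNl].
Qed.

End truncation_theory.

Section truncation_deviation.
Context {R : realType} {d : measure_display} {Omega : measurableType d}
  (P : probability Omega R).
Variables (beta : R) (psi : R -> R).
Hypotheses (beta_gt1 : 1 < beta) (psi_trunc : truncation (pow_lambda beta) psi).

Lemma measurable_truncation : measurable_fun [set: R] psi.
Proof. by apply: nondecreasing_measurable => // x y; exact: psi_trunc.1. Qed.

Lemma measurable_pow_lambda : measurable_fun [set: R] (pow_lambda beta).
Proof.
apply: measurable_funM => //; exact: (measurableT_comp (measurable_powR beta)).
Qed.

(** By [norm_le_pow_lambda], [|X|] is dominated by the integrable function
    [pow_lambda beta X + 1]. *)
Lemma integrable_pow_lambda (X : Omega -> R) : measurable_fun setT X ->
  (\int[P]_w (pow_lambda beta (X w))%:E < +oo)%E ->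
  P.-integrable setT (EFin \o X).
Proof.
move=> mX lX.
have mlX : measurable_fun setT (fun w => pow_lambda beta (X w)).
  exact: measurableT_comp measurable_pow_lambda mX.
have ilX : P.-integrable setT (EFin \o (fun w => pow_lambda beta (X w))).
  apply/integrableP; split; first exact/measurable_EFinP.
  under eq_integral do rewrite /= ger0_norm ?pow_lambda_ge0//; exact: lX.
have i1 : P.-integrable setT (EFin \o cst (1 : R)).
  exact: finite_measure_integrable_cst.
apply: le_integrable (integrableD measurableT ilX i1) => //.
  exact/measurable_EFinP.
move=> w _ /=; rewrite lee_fin [leRHS]ger0_norm ?addr_ge0 ?pow_lambda_ge0//.
have := norm_le_pow_lambda beta beta_gt1 (X w).
have : 0 < beta^-1 by rewrite invr_gt0 (lt_trans _ beta_gt1).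
lra.
Qed.

Lemma mgf_truncation_le (X : Omega -> R) (mu v : R) : measurable_fun setT X ->
  (\int[P]_w (X w)%:E = mu%:E)%E ->
  (\int[P]_w (pow_lambda beta (X w))%:E <= v%:E)%E ->
  (\int[P]_w (expR (psi (X w)))%:E <= (expR (mu + v))%:E)%E.
Proof.
move=> mX Xmu Xv.
have mlX : measurable_fun setT (fun w => pow_lambda beta (X w)).
  exact: measurableT_comp measurable_pow_lambda mX.
have lX_oo := le_lt_trans Xv (ltry v).
have iX := integrable_pow_lambda _ mX lX_oo.
have ilX : P.-integrable setT (EFin \o (fun w => pow_lambda beta (X w))).
  apply/integrableP; split; first exact/measurable_EFinP.
  by under eq_integral do rewrite /= ger0_norm ?pow_lambda_ge0//.
have i1 : P.-integrable setT (EFin \o cst (1 : R)).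
  exact: finite_measure_integrable_cst.
have i1X : P.-integrable setT (EFin \o (fun w => 1 + X w)).
  exact: (integrableD measurableT i1 iX).
apply: (@le_trans _ _ (\int[P]_w (1 + X w + pow_lambda beta (X w))%:E)%E).
  apply: ge0_le_integral => //.
  - apply/measurable_EFinP; apply: measurableT_comp => //.
    exact: measurableT_comp measurable_truncation mX.
  - apply/measurable_EFinP; apply: measurable_funD => //; exact: measurable_funD.
  - by move=> w _; rewrite lee_fin expR_truncation_le.
have -> : (\int[P]_w (1 + X w + pow_lambda beta (X w))%:E =
    (1 + mu)%:E + \int[P]_w (pow_lambda beta (X w))%:E)%E.
  rewrite (@integralD_EFin _ _ _ P _ measurableT _ _ i1X ilX); congr (_ + _)%E.
  rewrite (@integralD_EFin _ _ _ P _ measurableT _ _ i1 iX).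
  rewrite (_ : (\int[P]_x (EFin \o X) x)%E = mu%:E)//.
  have E1 : (\int[P]_x (EFin \o cst (1%R : R)) x = 1%:E)%E.
    transitivity (1%:E * P [set: Omega])%E; first by rewrite -(integral_cst P measurableT).
    by rewrite probability_setT mule1.
  by rewrite E1 -EFinD.
apply: (@le_trans _ _ ((1 + mu)%:E + v%:E)%E); first exact: leeD2l.
by rewrite -EFinD lee_fin -addrA expR_ge1Dx.
Qed.

End truncation_deviation.

(** * The Chernoff bound for an i.i.d. sample *)

Section iid_deviation.
Context {R : realType} {d d' : measure_display}
  {Omega : measurableType d} {E : measurableType d'} (P : probability Omega R).
Context {n : nat} (Zs : 'I_n -> {RV P >-> E}) (Z : {RV P >-> E}).
Hypothesis Zs_iid : iid_copies Zs Z.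

Lemma integral_copies (f : E -> R) i : measurable_fun [set: E] f ->
  (forall x, 0 <= f x) ->
  (\int[P]_w (f (Zs i w))%:E = \int[P]_w (f (Z w))%:E)%E.
Proof.
move=> mf f0.
have mEf : measurable_fun [set: E] (EFin \o f) by exact/measurable_EFinP.
have f0E y : (0 <= (EFin \o f) y)%E by rewrite lee_fin.
rewrite -(ge0_integral_distribution (Zs i) mEf f0E).
rewrite -(ge0_integral_distribution Z mEf f0E).
by apply: eq_measure_integral => A mA _; exact: Zs_iid.2.
Qed.

(** Markov's inequality for the exponential of the sum, whose expectation is at most [expR c ^+ n]
    by [integral_prod_le]. *)
Lemma chernoff_iid (f : E -> R) (c t : R) : measurable_fun [set: E] f ->
  (\int[P]_w (expR (f (Z w)))%:E <= (expR c)%:E)%E ->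
  (P [set w | (n%:R * c + t <= \sum_(i < n) f (Zs i w))%R] <= (expR (- t))%:E)%E.
Proof.
move=> mf fc.
have mef : measurable_fun [set: E] (fun x => expR (f x)).
  by apply: measurableT_comp.
have prod_le := integral_prod_le P Zs Zs_iid.1 (fun x => expR (f x)) (expR c) mef
  (fun x => expR_ge0 _).
pose G w : R := \prod_(i < n) expR (f (Zs i w)).
have mG : measurable_fun setT G.
  apply: measurable_prod => i _.
  exact: (measurableT_comp (f := fun x => expR (f x)) (g := Zs i)).
have GE w : G w = expR (\sum_(i < n) f (Zs i w)) by rewrite expR_sum.
have := @le_integral_abse _ _ _ P setT measurableT (EFin \o G) (expR (n%:R * c + t)).
rewrite setTI => /(_ _ (expR_gt0 _)) markov.
rewrite -(@lee_pmul2l _ (expR (n%:R * c + t))%:E) ?lte_fin ?expR_gt0//.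
have -> : [set w | n%:R * c + t <= \sum_(i < n) f (Zs i w)] =
    [set x | ((expR (n%:R * c + t))%:E <= `|(EFin \o G) x|)%E].
  apply/seteqP; split=> w /=; rewrite lee_fin GE ger0_norm ?expR_ge0// ler_expR//.
apply: le_trans (markov _) _; first exact/measurable_EFinP.
have -> : (\int[P]_x `|(EFin \o G) x| = \int[P]_x (G x)%:E)%E.
  by apply: eq_integral => w _ /=; rewrite GE ger0_norm ?expR_ge0.
apply: le_trans (prod_le _) _.
  move=> i; apply: le_trans fc.
  by rewrite (integral_copies (fun x => expR (f x)) i mef)// => x; exact: expR_ge0.
by rewrite -EFinM lee_fin -expRD addrK expRM_natl.
Qed.

End iid_deviation.

(** * The oracle inequality *)

Section parameter_dependence.
Context {R : realType} {d : measure_display} {Omega : measurableType d} {p : nat}.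

Lemma measurable_l2dist_le (theta : Omega -> 'rV[R]_p) (x : 'rV[R]_p) (c : R) :
  (forall j, measurable_fun [set: Omega] (fun w => theta w 0 j)) ->
  measurable [set w | l2norm (theta w - x) <= c].
Proof.
move=> mtheta.
have mdist : measurable_fun [set: Omega] (fun w => l2norm (theta w - x)).
  apply: (measurableT_comp (f := @Num.sqrt R)
    (g := fun w => \sum_(j < p) (theta w - x) 0 j ^+ 2)).
    by apply: continuous_measurable_fun => y; exact: sqrt_continuous.
  apply: measurable_sum => j; apply: measurable_funX.
  under eq_fun do rewrite !mxE.
  exact: measurable_funB.
by rewrite -[X in measurable X]setTI; exact: measurable_fun_le.
Qed.

(** Neither [Theta] nor [f] is assumed measurable. The sublevel set is instead a countable
    intersection, over scales, of finite unions of balls centred at those net points where [f] is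
    almost at most [c]. *)
Lemma measurable_lipschitz_sublevel (Theta : set 'rV[R]_p) (f : 'rV[R]_p -> R)
    (L c : R) (theta : Omega -> 'rV[R]_p) :
  (forall eps : R, 0 < eps -> exists t, eps_net Theta eps t) ->
  0 <= L ->
  (forall x y, Theta x -> Theta y -> f x - f y <= L * l2norm (x - y)) ->
  (forall j, measurable_fun [set: Omega] (fun w => theta w 0 j)) ->
  (forall w, Theta (theta w)) ->
  measurable [set w | f (theta w) <= c].
Proof.
move=> nets L0 fL mtheta thetaT.
have /choice[t tP] (k : nat) : exists t, eps_net Theta (k.+1%:R^-1 : R) t.
  by apply: nets; rewrite invr_gt0.
have -> : [set w | f (theta w) <= c] = \bigcap_k
    \big[setU/set0]_(x <- t k | f x <= c + L / k.+1%:R)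
      [set w | l2norm (theta w - x) <= k.+1%:R^-1].
  apply/seteqP; split=> w /=.
    move=> fw k _; have [x xt wx] := (tP k).2 _ (thetaT w).
    rewrite -bigcup_seq_cond; exists x => //=; rewrite xt/=.
    have := fL x (theta w) ((tP k).1 _ xt) (thetaT w).
    rewrite l2normB => h; have := ler_wpM2l L0 wx.
    by move: (L / k.+1%:R) => q; lra.
  (* The error [L / k.+1] occurs twice, in the selection of net points and in the move from the net
     point to [theta w]; [k] makes their sum at most [e]. *)
  move=> fw; apply/ler_addgt0Pl => e e0.
  have [k ke] : exists k : nat, 2 * L / k.+1%:R <= e.
    exists (Num.truncn (2 * L / e)).
    have LE : 0 <= 2 * L / e by rewrite divr_ge0 ?mulr_ge0// ltW.
    have /andP[_ h] := truncn_itv LE.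
    by rewrite ler_pdivrMr// [e * _]mulrC -ler_pdivrMr//; exact: ltW h.
  have := fw k Logic.I; rewrite -bigcup_seq_cond => -[x /= /andP[xt fx] wx].
  have := fL (theta w) x (thetaT w) ((tP k).1 _ xt).
  have := ler_wpM2l L0 wx.
  move: ke fx; rewrite -mulrA; move: (L / k.+1%:R) => q; lra.
apply: bigcap_measurable => // k _; apply: bigsetU_measurable => x _.
exact: measurable_l2dist_le.
Qed.

End parameter_dependence.

(** * Complexity of the net and choice of [alpha] *)

(** The left-hand side adds the two Chernoff exponents, for failure probability [delta] at one
    parameter and [delta / N] at each of [N] net points. It equals [ln (delta ^- 2 * N)], and
    [sparse_covering_bound] controls [N]. *)
Lemma log_complexity_ge (R : realType) (n p s N : nat) (r delta : R) :
  0 < delta -> 0 <= r -> (0 < s)%N -> (0 < N)%N ->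
  N%:R <= 'C(p, s)%:R * (1 + 2 * n%:R * r) ^+ s ->
  - ln delta - ln (delta / N%:R) <= log_complexity n p s r delta.
Proof.
move=> delta0 r0 s0 N0 N_le.
have N0R : 0 < N%:R :> R by rewrite ltr0n.
have t0 : 0 < s%:R :> R by rewrite ltr0n.
have e0 : 0 < expR 1 :> R by exact: expR_gt0.
have q0 : 0 < Num.sqrt (2 * expR 1 * s%:R) :> R by rewrite sqrtr_gt0 !mulr_gt0.
have := le_trans (ler_wpM2l (ltW q0) N_le) (@sparse_covering_bound R p n s r r0 s0).
set D := (1 + 2 * n%:R * r) * _ => ND.
(* Positivity of [p] is not among the hypotheses here; [D = 0] is excluded by [ND], whose left side
   is positive. *)
have D0 : 0 < D.
  have D_ge0 : 0 <= D.
    by rewrite !(mulr_ge0, addr_ge0, invr_ge0, expR_ge0).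
  rewrite lt0r D_ge0 andbT; apply/eqP => D0; move: ND.
  by rewrite D0 expr0n gtn_eqF//= leNgt mulr_gt0.
rewrite /log_complexity -/D (mulr_natl (ln D) s) -lnXn//.
rewrite -lnM ?posrE ?divr_gt0 ?invr_gt0 ?exprn_gt0//.
have -> : - ln delta - ln (delta / N%:R) = ln (delta ^- 2 * N%:R).
  rewrite [RHS]lnM ?posrE ?invr_gt0 ?exprn_gt0// [X in _ = X + _]lnV ?posrE ?exprn_gt0// lnXn//.
  by rewrite ln_div ?posrE// mulr2n; lra.
rewrite ler_ln ?posrE ?mulr_gt0 ?invr_gt0 ?exprn_gt0//.
rewrite -[leRHS]mulrA ler_wpM2l ?invr_ge0 ?exprn_ge0 ?(ltW delta0)//.
by rewrite mulrC ler_pdivlMr// mulrC.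
Qed.

Section tuning.
Context {R : realType}.
Variables (n p s : nat) (r delta beta Rlam EHb : R).
Hypotheses (n_gt0 : (0 < n)%N) (beta_gt1 : 1 < beta) (Rlam_gt0 : 0 < Rlam).
Let L := log_complexity n p s r delta.
Hypothesis L_gt0 : 0 < L.
Let alpha := alpha_tuning n p s r delta beta Rlam.
Let K : R := (2 `^ (beta - 1) + 1) * Rlam.

Let n0 : 0 < n%:R :> R. Proof. by rewrite ltr0n. Qed.
Let b0 : 0 < beta. Proof. exact: lt_trans beta_gt1. Qed.

Let K_gt0 : 0 < K.
Proof. by rewrite mulr_gt0// addr_gt0// powR_gt0. Qed.

Let alphaE : alpha = (L / (n%:R * K)) `^ beta^-1.
Proof.
rewrite /alpha /alpha_tuning -/L -/K div1r.
have -> : L / K = n%:R * (L / (n%:R * K)) by field; rewrite !gt_eqF.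
have Y0 : 0 <= L / (n%:R * K) by rewrite ltW// divr_gt0// mulr_gt0.
by rewrite powRM ?(ltW n0)// mulKf// gt_eqF// powR_gt0.
Qed.

Lemma alpha_tuning_gt0 : 0 < alpha.
Proof. by rewrite alphaE powR_gt0// divr_gt0// mulr_gt0. Qed.

(** The balance equation behind [alpha]: the sum of the Chernoff exponents, at most [L], is matched
    by a moment term. *)
Lemma alpha_tuning_powR : n%:R * (alpha `^ beta * K) = L.
Proof.
rewrite alphaE -powRrM mulVf ?gt_eqF// powRr1 ?divr_ge0 ?mulr_ge0 ?ltW//.
by field; rewrite !gt_eqF.
Qed.

(** Both sides carry the power [(beta - 1) / beta] of [L / (n * K)], since [alpha ^ (beta - 1)] is
    that power; the factor [K] goes into the denominator of [C_const]. *)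
Lemma C_const_tuning : C_const beta Rlam EHb / n%:R `^ ((beta - 1) / beta)
    * L `^ ((beta - 1) / beta) =
  alpha^-1 * (alpha `^ beta * (2 * K + 2 `^ (beta - 1) / beta * EHb)).
Proof.
have -> : alpha^-1 * (alpha `^ beta * (2 * K + 2 `^ (beta - 1) / beta * EHb)) =
    alpha `^ (beta - 1) * (2 * K + 2 `^ (beta - 1) / beta * EHb).
  have a0 := alpha_tuning_gt0.
  by rewrite mulrA [alpha `^ (beta - 1)]powRB ?(gt_eqF a0) ?implybT// powRr1 ?(ltW a0)// [_ / alpha]mulrC.
rewrite alphaE -powRrM [beta^-1 * _]mulrC /C_const -/K.
set q := (beta - 1) / beta.
set Y := L / (n%:R * K).
have Y0 : 0 <= Y by rewrite ltW// divr_gt0// mulr_gt0.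
have -> : L = n%:R * (K * Y) by rewrite /Y; field; rewrite !gt_eqF.
rewrite (powRM _ (ltW n0) (mulr_ge0 (ltW K_gt0) Y0)) (powRM _ (ltW K_gt0) Y0).
have nq : 0 < n%:R `^ q by rewrite powR_gt0.
have Kq : 0 < K `^ q by rewrite powR_gt0.
rewrite -[2 * _ * Rlam]mulrA -/K; move: nq Kq; move: (n%:R `^ q) (K `^ q) => u v u0 v0.
by field; rewrite !gt_eqF.
Qed.

End tuning.

(** * The oracle inequality against a fixed parameter *)

Section oracle_inequality.
Context {R : realType} {disp : measure_display} {Omega : measurableType disp}
  (P : probability Omega R) {n d p : nat}.
Variables (Z : {RV P >-> (d.-tuple R * R)%type})
  (Zs : 'I_n -> {RV P >-> (d.-tuple R * R)%type})
  (Theta : set 'rV[R]_p)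
  (l : R -> d.-tuple R -> 'rV[R]_p -> R) (beta : R)
  (H : R -> d.-tuple R -> R) (psi : R -> R).
Hypotheses (n_gt0 : (0 < n)%N) (Zs_iid : iid_copies Zs Z)
  (l_measurable : forall theta, Theta theta ->
    measurable_fun [set: d.-tuple R * R]
      (fun z : d.-tuple R * R => l z.2 z.1 theta))
  (beta_gt1 : 1 < beta)
  (H_measurable : measurable_fun [set: d.-tuple R * R]
      (fun z : d.-tuple R * R => H z.2 z.1))
  (H_ge0 : forall y x, 0 <= H y x)
  (l_lipschitz : forall y x theta1 theta2, Theta theta1 -> Theta theta2 ->
    `|l y x theta2 - l y x theta1| <= H y x * l2norm (theta2 - theta1))
  (Rlam_gt0 : (0 < sup_risk Z l (pow_lambda beta) Theta)%E)
  (Rlam_finite : (sup_risk Z l (pow_lambda beta) Theta < +oo)%E)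
  (EHbeta_finite : (moment_envelope Z H beta < +oo)%E)
  (psi_truncation : truncation (pow_lambda beta) psi).

Let Rlam := fine (sup_risk Z l (pow_lambda beta) Theta).
Let EHbeta := fine (moment_envelope Z H beta).
Let EH := fine (mean_envelope Z H).
Let mean theta := fine (risk Z l theta).
Let lZ theta w := l (Z w).2 (Z w).1 theta.
Let HZ w := H (Z w).2 (Z w).1.

Let beta_gt0 : 0 < beta. Proof. exact: lt_trans beta_gt1. Qed.

Let mlZ theta : Theta theta -> measurable_fun [set: Omega] (lZ theta).
Proof.
move=> thetaT.
exact: (measurableT_comp (f := fun z : d.-tuple R * R => l z.2 z.1 theta) (g := Z)
  (l_measurable _ thetaT)).
Qed.

Let mHZ : measurable_fun [set: Omega] HZ.
Proof.
exact: (measurableT_comp (f := fun z : d.-tuple R * R => H z.2 z.1) (g := Z)).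
Qed.

Let HZ_ge0 w : 0 <= HZ w. Proof. exact: H_ge0. Qed.

Lemma fine_sup_risk_gt0 : 0 < Rlam.
Proof. by apply: fine_gt0; rewrite Rlam_gt0. Qed.

Let moment_loss theta : Theta theta ->
  (\int[P]_w (pow_lambda beta (lZ theta w))%:E <= Rlam%:E)%E.
Proof.
move=> thetaT; rewrite fineK ?gt0_fin_numE//.
by apply: ereal_sup_ubound; exists theta => //; rewrite unlock.
Qed.

Let integrable_loss theta : Theta theta ->
  P.-integrable [set: Omega] (EFin \o lZ theta).
Proof.
move=> thetaT; apply: (integrable_pow_lambda P beta beta_gt1) => //.
  exact: mlZ.
exact: le_lt_trans (moment_loss _ thetaT) (ltry _).
Qed.

Let moment_H : (\int[P]_w (pow_lambda beta (HZ w))%:E = (EHbeta / beta)%:E)%E.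
Proof.
have HE : moment_envelope Z H beta = (\int[P]_w ((HZ w) `^ beta)%:E)%E.
  by rewrite /moment_envelope unlock.
have H0 : (0 <= moment_envelope Z H beta)%E.
  by rewrite HE integral_ge0// => w _; rewrite lee_fin powR_ge0.
have fH : moment_envelope Z H beta \is a fin_num by rewrite ge0_fin_numE.
transitivity (\int[P]_w (beta^-1%:E * (HZ w `^ beta)%:E))%E.
  by apply: eq_integral => w _; rewrite /pow_lambda (ger0_norm (HZ_ge0 w)) mulrC EFinM.
rewrite ge0_integralZl_EFin//.
- by rewrite -HE mulrC EFinM fineK.
- by move=> w _; rewrite lee_fin powR_ge0.
- by apply/measurable_EFinP; exact: (measurableT_comp (measurable_powR beta)).
- by rewrite invr_ge0 ltW.
Qed.

Let integrable_H : P.-integrable [set: Omega] (EFin \o HZ).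
Proof.
by apply: (integrable_pow_lambda P beta beta_gt1) => //; rewrite moment_H ltry.
Qed.

Lemma mean_envelopeE : mean_envelope Z H = EH%:E.
Proof.
rewrite /EH fineK// /mean_envelope unlock; exact: integrable_fin_num.
Qed.

Lemma riskE theta : Theta theta -> risk Z l theta = (mean theta)%:E.
Proof.
move=> thetaT; rewrite /mean fineK// /risk unlock.
exact: (integrable_fin_num _ (integrable_loss _ thetaT)).
Qed.

Let integral_H : (\int[P]_w (HZ w)%:E = EH%:E)%E.
Proof. by rewrite -mean_envelopeE /mean_envelope unlock. Qed.

Let integral_loss theta : Theta theta ->
  (\int[P]_w (lZ theta w)%:E = (mean theta)%:E)%E.
Proof. by move=> thetaT; rewrite -riskE// /risk unlock. Qed.

Lemma mean_envelope_ge0 : 0 <= EH.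
Proof.
by rewrite -lee_fin -integral_H integral_ge0// => w _; rewrite lee_fin.
Qed.

Lemma risk_lipschitz theta1 theta2 : Theta theta1 -> Theta theta2 ->
  mean theta1 - mean theta2 <= EH * l2norm (theta1 - theta2).
Proof.
move=> T1 T2; have i1 := integrable_loss _ T1; have i2 := integrable_loss _ T2.
rewrite -lee_fin EFinM -integral_H.
have <- : (\int[P]_w (lZ theta1 w - lZ theta2 w)%:E =
    (mean theta1 - mean theta2)%:E)%E.
  rewrite [in RHS]EFinB -!integral_loss//; exact: (integralB_EFin measurableT i1 i2).
rewrite -(integralZr measurableT integrable_H).
apply: le_integral => //.
- exact: (integrableB measurableT i1 i2).
- exact: (integrableZr measurableT _ integrable_H).
- move=> w _; rewrite lee_fin; apply: le_trans (ler_norm _) _; exact: l_lipschitz.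
Qed.

Lemma measurable_risk_le (thetahat : Omega -> 'rV[R]_p) (c : R) :
  (forall eps : R, 0 < eps -> exists t, eps_net Theta eps t) ->
  (forall j, measurable_fun [set: Omega] (fun w => thetahat w 0 j)) ->
  (forall w, Theta (thetahat w)) ->
  measurable [set w | mean (thetahat w) <= c].
Proof.
move=> nets mtheta thetaT.
apply: (measurable_lipschitz_sublevel Theta mean EH c thetahat nets) => //.
  exact: mean_envelope_ge0.
by move=> x y; exact: risk_lipschitz.
Qed.

Let upper_deviation (a t : R) theta : 0 <= a -> Theta theta ->
  (P [set w | (n%:R * (a * mean theta + a `^ beta * Rlam) + t <=
      \sum_(i < n) psi (a * l (Zs i w).2 (Zs i w).1 theta))%R] <=
   (expR (- t))%:E)%E.
Proof.
move=> a0 thetaT.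
apply: (chernoff_iid P Zs Z Zs_iid (fun z => psi (a * l z.2 z.1 theta))).
  apply: (measurableT_comp (measurable_truncation _ _ psi_truncation)).
  by apply: measurable_funM => //; exact: l_measurable.
apply: (mgf_truncation_le P beta psi beta_gt1 psi_truncation (fun w => a * lZ theta w)).
- by apply: measurable_funM => //; exact: mlZ.
- under eq_integral do rewrite EFinM.
  by rewrite (integralZl measurableT (integrable_loss _ thetaT)) integral_loss.
- under eq_integral do rewrite pow_lambdaM// EFinM.
  rewrite ge0_integralZl_EFin ?powR_ge0//.
  + rewrite EFinM lee_wpmul2l ?lee_fin ?powR_ge0//; exact: moment_loss.
  + by move=> w _; rewrite lee_fin pow_lambda_ge0.
  + apply/measurable_EFinP.
    exact: (measurableT_comp (measurable_pow_lambda beta) (mlZ _ thetaT)).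
Qed.

(** Subtracting [h * H] inside [psi] prepares the passage from a net point to its neighbours. The
    moment of the difference is split by [pow_lambdaD], and [h <= 1] allows [h ^ beta] to be bounded
    by [1]. *)
Let lower_deviation (a h t : R) theta : 0 <= a -> 0 <= h <= 1 -> Theta theta ->
  (P [set w | (n%:R * (- a * (mean theta - h * EH) +
         a `^ beta * (2 `^ (beta - 1) * (Rlam + EHbeta / beta))) + t <=
      \sum_(i < n) - psi (a * (l (Zs i w).2 (Zs i w).1 theta -
         h * H (Zs i w).2 (Zs i w).1)))%R] <=
   (expR (- t))%:E)%E.
Proof.
move=> a0 /andP[h0 h1] thetaT.
pose f (z : d.-tuple R * R) : R := - (a * (l z.2 z.1 theta - h * H z.2 z.1)).
have mf : measurable_fun [set: d.-tuple R * R] f.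
  apply: measurable_funN; apply: measurable_funM => //.
  by apply: measurable_funB; [exact: l_measurable|exact: measurable_funM].
have tr := truncationN beta psi psi_truncation.
have mlt := measurableT_comp (measurable_pow_lambda beta) (mlZ _ thetaT).
have mht := measurableT_comp (measurable_pow_lambda beta) mHZ.
have mft : measurable_fun [set: Omega] (fun w => f (Z w)).
  exact: (measurableT_comp mf).
apply: (chernoff_iid P Zs Z Zs_iid
  (fun z => - psi (a * (l z.2 z.1 theta - h * H z.2 z.1)))).
  apply: measurable_funN; apply: (measurableT_comp (measurable_truncation _ _ psi_truncation)).
  apply: measurable_funM => //.
  by apply: measurable_funB; [exact: l_measurable|exact: measurable_funM].
have mean_f : (\int[P]_w (f (Z w))%:E = (- a * (mean theta - h * EH))%:E)%E.
  have iHh := integrableZl measurableT h integrable_H.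
  have iL := integrable_loss _ thetaT.
  transitivity (\int[P]_w ((- a)%:E * (lZ theta w - h * HZ w)%:E))%E.
    by apply: eq_integral => w _; rewrite -EFinM mulNr.
  rewrite (integralZl measurableT (integrableB measurableT iL iHh)).
  rewrite EFinM; congr (_ * _)%E; rewrite EFinB EFinM -integral_H -integral_loss//.
  rewrite -(integralZl measurableT integrable_H).
  exact: (integralB_EFin measurableT iL iHh).
have moment_f : (\int[P]_w (pow_lambda beta (f (Z w)))%:E <=
    (a `^ beta * (2 `^ (beta - 1) * (Rlam + EHbeta / beta)))%:E)%E.
  apply: (@le_trans _ _ (\int[P]_w ((a `^ beta * 2 `^ (beta - 1))%:E *
      ((pow_lambda beta (lZ theta w))%:E + (pow_lambda beta (HZ w))%:E)))%E).
    apply: ge0_le_integral => //.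
    + by move=> w _; rewrite lee_fin pow_lambda_ge0.
    + by apply/measurable_EFinP; exact: (measurableT_comp (measurable_pow_lambda beta)).
    + apply: emeasurable_funM => //.
      by apply: emeasurable_funD; exact/measurable_EFinP.
    + move=> w _; rewrite -EFinD -EFinM lee_fin /f pow_lambdaN pow_lambdaM// -mulrA.
      rewrite ler_wpM2l ?powR_ge0//.
      apply: le_trans (pow_lambdaD beta beta_gt1 _ _) _.
      rewrite ler_wpM2l ?powR_ge0// lerD2l pow_lambdaN pow_lambdaM//.
      rewrite ler_piMl ?pow_lambda_ge0//.
      have -> : 1 = 1 `^ beta :> R by rewrite powR1.
      by apply: ge0_ler_powR; rewrite ?nnegrE ?(ltW beta_gt0).
  rewrite ge0_integralZl_EFin ?mulr_ge0 ?powR_ge0//; last 2 first.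
  + by move=> w _; rewrite adde_ge0 ?lee_fin ?pow_lambda_ge0.
  + by apply: emeasurable_funD; exact/measurable_EFinP.
  rewrite ge0_integralD//; last 4 first.
  + by move=> w _; rewrite lee_fin pow_lambda_ge0.
  + exact/measurable_EFinP.
  + by move=> w _; rewrite lee_fin pow_lambda_ge0.
  + exact/measurable_EFinP.
  rewrite moment_H mulrA [leRHS]EFinM.
  rewrite lee_wpmul2l ?lee_fin ?mulr_ge0 ?powR_ge0// EFinD leeD2r//.
  exact: moment_loss.
have := mgf_truncation_le P beta _ beta_gt1 tr (fun w => f (Z w)) _ _ mft mean_f moment_f.
by under eq_integral do rewrite opprK.
Qed.

Let K : R := (2 `^ (beta - 1) + 1) * Rlam.

Let v : R := 2 `^ (beta - 1) * (Rlam + EHbeta / beta).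

Let n0 : 0 < n%:R :> R. Proof. by rewrite ltr0n. Qed.

(** The deterministic half of the argument, for a sample on which no deviation event occurs. It
    chains the lower bound at a net point near [theta1], monotonicity of [psi], minimality of
    [theta1], and the upper bound at [theta0]. *)
Let excess_risk_le (a t1 t2 rho gamma : R) (z : 'I_n -> d.-tuple R * R)
    (net : seq 'rV[R]_p) (theta0 theta1 : 'rV[R]_p) :
  0 < a -> 0 <= rho -> 0 <= gamma -> eps_net Theta n%:R^-1 net -> Theta theta0 ->
  argmin_set Theta (regularized_empirical_risk l psi a rho gamma z) theta1 ->
  \sum_(i < n) psi (a * l (z i).2 (z i).1 theta0) <
    n%:R * (a * mean theta0 + a `^ beta * Rlam) + t1 ->
  (forall theta, theta \in net ->
    \sum_(i < n) - psi (a * (l (z i).2 (z i).1 theta -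
        n%:R^-1 * H (z i).2 (z i).1)) <
    n%:R * (- a * (mean theta - n%:R^-1 * EH) + a `^ beta * v) + t2) ->
  t1 + t2 <= n%:R * (a `^ beta * K) ->
  mean theta1 <= mean theta0 + (2 / n%:R * EH +
    a^-1 * (a `^ beta * (2 * K + 2 `^ (beta - 1) / beta * EHbeta)) +
    penalty rho gamma theta0).
Proof.
move=> a0 rho0 gamma0 [netT cover] T0 [T1 theta1_min] up low t12.
have [theta theta_net near_theta] := cover _ T1.
have T : Theta theta := netT _ theta_net.
have {low} := low _ theta_net; rewrite sumrN => low.
have emp_ge : \sum_(i < n) psi (a * (l (z i).2 (z i).1 theta -
      n%:R^-1 * H (z i).2 (z i).1)) <=
    \sum_(i < n) psi (a * l (z i).2 (z i).1 theta1).
  apply: ler_sum => i _; apply: psi_truncation.1; rewrite ler_pM2l// lerBlDr.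
  have := l_lipschitz (z i).2 (z i).1 _ _ T1 T; rewrite l2normB.
  have := ler_wpM2l (H_ge0 (z i).2 (z i).1) near_theta.
  rewrite [_^-1 * _]mulrC => h1 h2; have := le_trans (ler_norm _) (le_trans h2 h1).
  by rewrite lerBlDl addrC.
have pen0 := penalty_ge0 rho gamma theta1 rho0 gamma0.
have := theta1_min _ T0; rewrite /regularized_empirical_risk.
set S1 := \sum_(i < n) psi (a * l (z i).2 (z i).1 theta1) in emp_ge *.
set S0 := \sum_(i < n) psi (a * l (z i).2 (z i).1 theta0) in up *.
move=> emp_min.
have na0 : 0 < n%:R * a by rewrite mulr_gt0.
have {emp_min} S10 : S1 <= S0 + n%:R * a * penalty rho gamma theta0.
  have : (n%:R * a)^-1 * S1 <= (n%:R * a)^-1 * S0 + penalty rho gamma theta0.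
    by apply: le_trans emp_min; rewrite lerDl.
  rewrite ler_pdivrMl// mulrDr mulrA mulfV ?mul1r//; exact: lt0r_neq0.
have mean_near : mean theta1 - n%:R^-1 * EH <= mean theta.
  have := risk_lipschitz _ _ T1 T; have := ler_wpM2l mean_envelope_ge0 near_theta.
  rewrite [EH * _^-1]mulrC; lra.
(* The three terms come from the upper deviation, the lower deviation, and the exponents
   [t1 + t2]. *)
have KE : Rlam + v + K = 2 * K + 2 `^ (beta - 1) / beta * EHbeta.
  by rewrite /v /K; field; rewrite gt_eqF.
rewrite -KE -(ler_pM2l na0).
(* The factor [2] in front of [EH / n] counts the shift by [H / n] inside [psi] and the change of
   mean risk in [mean_near]. *)
have -> : n%:R * a * (mean theta0 + (2 / n%:R * EH +
      a^-1 * (a `^ beta * (Rlam + v + K)) + penalty rho gamma theta0)) =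
    n%:R * (a * mean theta0 + a `^ beta * Rlam) + 2 * (n%:R * a * (n%:R^-1 * EH)) +
      n%:R * (a `^ beta * v) + n%:R * (a `^ beta * K)
      + n%:R * a * penalty rho gamma theta0.
  by field; rewrite !gt_eqF.
have := ler_wpM2l (ltW na0) mean_near.
move: emp_ge low; set S := \sum_(i < n) _ => emp_ge.
have -> : n%:R * (- a * (mean theta - n%:R^-1 * EH) + a `^ beta * v) =
  - (n%:R * a * mean theta) + n%:R * a * (n%:R^-1 * EH) + n%:R * (a `^ beta * v).
  by ring.
lra.
Qed.

Variables (s : nat) (r delta rho gamma : R) (thetahat : Omega -> 'rV[R]_p).
Let alpha := alpha_tuning n p s r delta beta Rlam.
Hypotheses (nets : forall eps : R, 0 < eps -> exists t, eps_net Theta eps t)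
  (net_n : exists2 t, eps_net Theta (n%:R^-1 : R) t &
    (size t)%:R <= 'C(p, s)%:R * (1 + 2 * n%:R * r) ^+ s)
  (r_ge0 : 0 <= r) (s_gt0 : (0 < s)%N) (delta_bounds : 0 < delta < 1 / 2)
  (rho_ge0 : 0 <= rho) (gamma_ge0 : 0 <= gamma)
  (thetahat_measurable : forall j : 'I_p,
    measurable_fun [set: Omega] (fun w => thetahat w 0 j))
  (thetahat_min : forall w, argmin_set Theta
     (regularized_empirical_risk l psi alpha rho gamma (fun i => Zs i w))
     (thetahat w)).

Let bound := 2 / n%:R * EH + C_const beta Rlam EHbeta / n%:R `^ ((beta - 1) / beta)
    * log_complexity n p s r delta `^ ((beta - 1) / beta).

(** A union bound over [U], the upper deviation at [theta0], and [V], the lower deviations over the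
    net, each of probability at most [delta]. Leaving [theta0] free allows it to range later over
    minimizers of nearly optimal penalty. *)
Lemma oracle_inequality theta0 : Theta theta0 ->
  ((1 - 2 * delta)%:E <= P [set w | (mean (thetahat w) <=
     mean theta0 + (bound + penalty rho gamma theta0))%R])%E.
Proof.
move=> T0; have [net netP net_size] := net_n.
have /andP[delta0 delta_half] := delta_bounds.
have N0 : (0 < size net)%N.
  by have [x + _] := netP.2 _ T0; case: (net).
have N0R : 0 < (size net)%:R :> R by rewrite ltr0n.
have L_ge := log_complexity_ge R n p s (size net) r delta delta0 r_ge0 s_gt0 N0 net_size.
(* The lower bound [L_ge] is [- ln (delta * (delta / N))], positive because [delta < 1 / 2] and
   [N >= 1]. *)
have L_gt0 : 0 < log_complexity n p s r delta.
  apply: lt_le_trans L_ge; rewrite -opprD oppr_gt0 -lnM ?posrE ?divr_gt0//.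
  apply: ln_lt0; rewrite mulr_gt0 ?divr_gt0//= mulrA ltr_pdivrMr// mul1r.
  have : 1 <= (size net)%:R :> R by rewrite ler1n.
  nra.
have Rlam0 := fine_sup_risk_gt0.
have alpha0 : 0 < alpha.
  exact: alpha_tuning_gt0.
have hn : 0 <= (n%:R^-1 : R) <= 1.
  by rewrite invr_ge0 ltW//= invf_le1// ler1n.
pose t1 := - ln delta; pose t2 := - ln (delta / (size net)%:R).
pose U := [set w | n%:R * (alpha * mean theta0 + alpha `^ beta * Rlam) + t1 <=
    \sum_(i < n) psi (alpha * l (Zs i w).2 (Zs i w).1 theta0)].
pose D x := [set w | n%:R * (- alpha * (mean x - n%:R^-1 * EH) +
    alpha `^ beta * v) + t2 <=
    \sum_(i < n) - psi (alpha * (l (Zs i w).2 (Zs i w).1 x -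
       n%:R^-1 * H (Zs i w).2 (Zs i w).1))].
have PU : (P U <= delta%:E)%E.
  have -> : delta = expR (- t1) by rewrite /t1 opprK lnK.
  exact: (upper_deviation _ _ _ (ltW alpha0) T0).
have PD x : x \in net -> (P (D x) <= (delta / (size net)%:R)%:E)%E.
  move=> /netP.1 Tx.
  have -> : delta / (size net)%:R = expR (- t2).
    by rewrite /t2 opprK lnK// posrE divr_gt0.
  exact: (lower_deviation _ _ _ _ (ltW alpha0) hn Tx).
have mZs i (f : d.-tuple R * R -> R) : measurable_fun setT f ->
    measurable_fun [set: Omega] (fun w => f (Zs i w)).
  by move=> mf; exact: (measurableT_comp mf).
have mpsi := measurable_truncation _ _ psi_truncation.
have mU : measurable U.
  rewrite -[X in measurable X]setTI; apply: measurable_fun_le => //.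
  apply: measurable_sum => i; apply: (measurableT_comp mpsi).
  by apply: measurable_funM => //; exact: (mZs i _ (l_measurable _ T0)).
have mD x : x \in net -> measurable (D x).
  move=> /netP.1 Tx.
  rewrite -[X in measurable X]setTI; apply: measurable_fun_le => //.
  apply: measurable_sum => i; apply: measurable_funN; apply: (measurableT_comp mpsi).
  apply: measurable_funM => //; apply: measurable_funB.
    exact: (mZs i _ (l_measurable _ Tx)).
  by apply: measurable_funM => //; exact: (mZs i _ H_measurable).
(* Boole's inequality takes events indexed by naturals; the default [theta0] is only met beyond the
   length of the net. *)
pose x_ i := nth theta0 net i.
pose V := \big[setU/set0]_(i < size net) D (x_ i).
have mDx i : (i < size net)%N -> measurable (D (x_ i)).
  by move=> i_lt; apply: mD; exact: mem_nth.
have mV : measurable V by apply: bigsetU_measurable => i _; exact: mDx.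
have PV : (P V <= delta%:E)%E.
  apply: le_trans (@Boole_inequality _ _ _ P (fun i => D (x_ i)) _ mDx) _.
  apply: (@le_trans _ _ (\sum_(i < size net) (delta / (size net)%:R)%:E)%E).
    by apply: lee_sum => i _; apply: PD; exact: mem_nth.
  rewrite sumEFin sumr_const card_ord lee_fin -[leLHS]mulr_natr divfK//.
  exact: lt0r_neq0.
have PUV : (P (U `|` V) <= (2 * delta)%:E)%E.
  apply: le_trans (measureU2 _ mU mV) _.
  by rewrite mulr_natl mulr2n EFinD leeD.
apply: (@le_trans _ _ (P (~` (U `|` V)))).
  by rewrite probability_setC ?EFinB; [exact: leeB|exact: measurableU].
apply: le_measure; rewrite ?inE.
- by apply: measurableC; exact: measurableU.
- by apply: measurable_risk_le => // w; case: (thetahat_min w).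
move=> w /= /not_orP[/negP Uw Vw]; rewrite /bound C_const_tuning//.
apply: (excess_risk_le alpha t1 t2 rho gamma (fun i => Zs i w) net) => //.
- by rewrite ltNge.
- move=> x xnet; rewrite ltNge; apply/negP => Dw; apply: Vw.
  suff : (\bigcup_(i < size net) D (x_ i)) w by rewrite bigcup_mkord.
  exists (index x net) => /=; first by rewrite index_mem.
  by rewrite /x_ nth_index.
- by apply: le_trans L_ge _; rewrite alpha_tuning_powR.
Qed.

End oracle_inequality.

(** * From a fixed parameter to the infimum over all risk minimizers *)

Theorem theorem8 (R : realType) (disp : measure_display)
  (Omega : measurableType disp) (P : probability Omega R)
  (n d p : nat) (n_gt0 : (0 < n)%N)
  (Z : {RV P >-> (d.-tuple R * R)%type})
  (Zs : 'I_n -> {RV P >-> (d.-tuple R * R)%type})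
  (Zs_iid : iid_copies Zs Z)
  (Theta0 : set 'rV[R]_p) (r : R) (s : nat)
  (Theta0_convex : convex_set (Theta0 : set (convex_lmodType 'rV[R]_p)))
  (r_gt0 : 0 < r)
  (Theta0_bounded : forall theta, Theta0 theta -> l2norm theta <= r)
  (s_bounds : (1 <= s <= p)%N)
  (l : R -> d.-tuple R -> 'rV[R]_p -> R)
  (l_measurable : forall theta, sparse_set Theta0 s theta ->
    measurable_fun [set: d.-tuple R * R]
      (fun z : d.-tuple R * R => l z.2 z.1 theta))
  (beta : R) (beta_bounds : 1 < beta < 2)
  (H : R -> d.-tuple R -> R)
  (H_measurable : measurable_fun [set: d.-tuple R * R]
      (fun z : d.-tuple R * R => H z.2 z.1))
  (H_ge0 : forall y x, 0 <= H y x)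
  (l_lipschitz : forall y x theta1 theta2,
    sparse_set Theta0 s theta1 -> sparse_set Theta0 s theta2 ->
    `|l y x theta2 - l y x theta1| <= H y x * l2norm (theta2 - theta1))
  (Rlam_gt0 :
    (0 < sup_risk Z l (pow_lambda beta) (sparse_set Theta0 s))%E)
  (Rlam_finite :
    (sup_risk Z l (pow_lambda beta) (sparse_set Theta0 s) < +oo)%E)
  (EHbeta_finite : (moment_envelope Z H beta < +oo)%E)
  (psi : R -> R) (psi_truncation : truncation (pow_lambda beta) psi)
  (delta rho gamma : R) (delta_bounds : 0 < delta < 1 / 2)
  (rho_gt0 : 0 < rho) (gamma_gt0 : 0 < gamma)
  (thetahat : Omega -> 'rV[R]_p)
  (thetahat_measurable : forall j : 'I_p,
    measurable_fun [set: Omega] (fun w => thetahat w 0 j)) :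
  let Theta := sparse_set Theta0 s in
  let Rlam := fine (sup_risk Z l (pow_lambda beta) Theta) in
  let EHbeta := fine (moment_envelope Z H beta) in
  let alpha := alpha_tuning n p s r delta beta Rlam in
  (forall w, argmin_set Theta
     (regularized_empirical_risk l psi alpha rho gamma (fun i => Zs i w))
     (thetahat w)) ->
  ((1 - 2 * delta)%:E <=
   P [set w |
      risk Z l (thetahat w) - ereal_inf [set risk Z l theta | theta in Theta]
      <= (2 / n%:R)%:E * mean_envelope Z H
         + (C_const beta Rlam EHbeta / n%:R `^ ((beta - 1) / beta)
            * log_complexity n p s r delta `^ ((beta - 1) / beta))%:E
         + penalty_of_minimizers Z l rho gamma Theta])%E.
Proof.
move=> Theta Rlam EHbeta alpha thetahat_min.
have /andP[beta_gt1 _] := beta_bounds; have /andP[s_gt0 s_le] := s_bounds.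
(* Nets at every scale serve measurability of the risk of [thetahat]; the net at scale [1 / n] with
   its size bound serves the union bound. *)
have nets (eps : R) : 0 < eps -> exists t, eps_net Theta eps t.
  move=> eps0; have [t] := exists_sparse_net Theta0 r eps s (ltW r_gt0) eps0 Theta0_bounded s_le.
  by exists t.
have net_n : exists2 t, eps_net Theta (n%:R^-1 : R) t &
    (size t)%:R <= 'C(p, s)%:R * (1 + 2 * n%:R * r) ^+ s.
  have n0 : 0 < n%:R^-1 :> R by rewrite invr_gt0 ltr0n.
  have [t] := exists_sparse_net Theta0 r _ s (ltW r_gt0) n0 Theta0_bounded s_le.
  by rewrite invrK [2 * r * _]mulrAC; exists t.
have EHE : mean_envelope Z H = (fine (mean_envelope Z H))%:E.
  exact: (mean_envelopeE P Z beta H).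
pose m x := fine (risk Z l x).
have rE x : Theta x -> risk Z l x = (m x)%:E.
  by move=> Tx; apply: (riskE P Z Theta l beta).
pose B := 2 / n%:R * fine (mean_envelope Z H)
  + C_const beta Rlam EHbeta / n%:R `^ ((beta - 1) / beta)
    * log_complexity n p s r delta `^ ((beta - 1) / beta).
have thetahatT w : Theta (thetahat w) by case: (thetahat_min w).
have oracle x : Theta x -> ((1 - 2 * delta)%:E <=
    P [set w | (m (thetahat w) <= m x + (B + penalty rho gamma x))%R])%E.
  by apply: (oracle_inequality P Z Zs Theta l beta H psi) => //; exact: ltW.
have msub c : measurable [set w | m (thetahat w) <= c].
  by apply: (measurable_risk_le P Z Theta l beta H).
(* Without a minimizer the penalty term is the infimum of the empty set, [+oo], and the event is the
   whole space. *)
have [argmin0|/set0P[x0 [Tx0 x0_min]]] := eqVneq (argmin_set Theta (risk Z l)) set0.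
  rewrite /penalty_of_minimizers -[argmin_set _ _]/(argmin_set Theta (risk Z l)) argmin0 image_set0 ereal_inf0.
  rewrite EHE -EFinM -EFinD addey//.
  rewrite (_ : [set _ | _] = setT); last first.
    by apply/seteqP; split=> // w _ /=; rewrite leey.
  by rewrite probability_setT lee_fin lerBlDr lerDl mulr_ge0//; lra.
have inf_risk : ereal_inf [set risk Z l x | x in Theta] = (m x0)%:E.
  apply/eqP; rewrite eq_le -rE// ereal_inf_lbound/=; last by exists x0.
  by apply: le_ereal_inf_tmp => _ [x Tx <-]; exact: x0_min.
set pen := penalty_of_minimizers _ _ _ _ _.
have pen0 : (0 <= pen)%E.
  by apply: le_ereal_inf_tmp => _ [x _ <-]; rewrite lee_fin penalty_ge0// ltW.
have pen_fin : pen \is a fin_num.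
  rewrite ge0_fin_numE//; apply: (@le_lt_trans _ _ (penalty rho gamma x0)%:E).
    by apply: ereal_inf_lbound; exists x0.
  exact: ltry.
(* The slack [k.+1^-1] leaves room for a minimizer whose penalty is strictly below
   [pen + k.+1^-1]. *)
have -> : [set w | (risk Z l (thetahat w) - ereal_inf [set risk Z l x | x in Theta]
      <= (2 / n%:R)%:E * mean_envelope Z H
         + (C_const beta Rlam EHbeta / n%:R `^ ((beta - 1) / beta)
            * log_complexity n p s r delta `^ ((beta - 1) / beta))%:E + pen)%E] =
    \bigcap_k [set w | m (thetahat w) <= m x0 + (B + fine pen + k.+1%:R^-1)].
  rewrite inf_risk EHE -(fineK pen_fin); apply/seteqP; split=> w /=.
    rewrite rE// -EFinB -EFinM -!EFinD lee_fin lerBlDl => h k _ /=.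
    apply: le_trans h _; rewrite lerD2l lerDl invr_ge0//.
  move=> h; rewrite rE// -EFinB -EFinM -!EFinD lee_fin lerBlDl.
  apply/ler_addgt0Pl => e e0.
  have := h (Num.truncn e^-1) Logic.I; move=> /le_trans; apply.
  rewrite addrA addrC lerD2r -[leRHS]invrK lef_pV2 ?posrE ?invr_gt0//.
  have e1 : 0 <= e^-1 by rewrite invr_ge0 ltW.
  by have /andP[_ /ltW] := truncn_itv e1.
set F := fun k : nat => _.
have mF k : measurable (F k) by exact: msub.
have mFI : measurable (\bigcap_k F k) by exact: bigcap_measurable.
have niF : nonincreasing_seq F.
  move=> i j ij; apply/subsetPset => w /= /le_trans; apply.
  by rewrite lerD2l lerD2l lef_pV2 ?posrE// ler_nat ltnS.
have PF k : ((1 - 2 * delta)%:E <= P (F k))%E.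
  have : (pen < (fine pen + k.+1%:R^-1)%:E)%E.
    by rewrite -{1}(fineK pen_fin) lte_fin ltrDl invr_gt0.
  (* This minimizer [x] depends on [k] but its risk does not exceed that of [x0], so [oracle] at [x]
     gives an event contained in [F k]. *)
  move=> /ereal_inf_lt[_ [x [Tx x_min] <-]]; rewrite lte_fin => pen_x.
  apply: le_trans (oracle _ Tx) _; apply: le_measure.
  - by rewrite inE; exact: msub.
  - by rewrite inE; exact: mF.
  move=> w /= /le_trans; apply.
  have : m x <= m x0 by rewrite -lee_fin -!rE//; exact: x_min.
  move: pen_x; move: (k.+1%:R^-1) => e; lra.
(* Continuity from above carries the bound, uniform in [k], to the intersection. *)
have cvgF := nonincreasing_cvg_mu (le_lt_trans (probability_le1 P (mF 0%N)) (ltry 1)) mF mFI niF.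
rewrite -(cvg_lim _ cvgF)//; apply: lime_ge; first exact: cvgP cvgF.
exact: nearW.
Qed.
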